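(* Let $m$, $n$ and $d$ be positive integers with $m<d$, and let $b$ be a real number with $b\notin \mathbb{Z}/d$. Put $t_1=e^{-2\pi i mb}$, $t_2=e^{-2\pi i db}$, $t_1'=e^{2\pi i mb}$ and $t_2'=e^{2\pi i db}$. Then $$\sum_{j=0}^{d-1} \cos\Big(\frac{2\pi mj}{d}\Big)\csc^{2n}\Big(\frac{\pi j}{d}+\pi b\Big) = -\sum i^{\mu+\nu+1}\,2^{\mu+\nu}\,\frac{m^\mu}{\mu!}\,\frac{d^{\nu+1}}{\nu!}\Big(t_1 A_\nu(t_2)-(-1)^{\mu+\nu}t_1' A_\nu(t_2')\Big)F(j_1,\ldots,j_{2n}),$$ where the sum on the right is over all nonnegative integers $j_1,\ldots,j_{2n},\mu,\nu$ such that $2j_1+\cdots+2j_{2n}+\mu+\nu=2n-1$ (so that $\mu+\nu+1$ is even).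
   Context: Here $i$ is the imaginary unit, $\csc$ denotes the cosecant, and $\mathbb{Z}/d=\{k/d : k\in\mathbb{Z}\}$. For a complex number $t\neq 1$, the numbers $A_\nu(t)$, $\nu\ge 0$, are defined by the power series expansion about $z=0$: $\frac{1}{te^z-1}=\sum_{\nu=0}^{\infty}\frac{A_\nu(t)}{\nu!}z^\nu$ (e.g. $A_0(t)=\frac{1}{t-1}$, $A_1(t)=\frac{-t}{(t-1)^2}$). For $j\ge 0$, $G_j=\frac{(-1)^j\,2(2^{2j-1}-1)B_{2j}}{(2j)!}$, where $B_k$ are the Bernoulli numbers ($\frac{x}{e^x-1}=\sum_{k\ge 0}B_k\frac{x^k}{k!}$); thus $G_0=-1$, $G_1=-\frac16$, $G_2=-\frac{7}{360}$, and these are the coefficients in $-\csc(\pi w)=\sum_{j\ge 0}G_j\pi^{2j-1}w^{2j-1}$ near $w=0$. Finally $F(j_1,\ldots,j_{N})=\prod_{r=1}^{N}G_{j_r}$. *)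

(* Defs.v *)
From HB Require Import structures.
From mathcomp Require Import all_boot all_order all_algebra.
From mathcomp Require Import all_classical all_reals all_analysis.
From mathcomp Require Import complex.

Set Implicit Arguments.
Unset Strict Implicit.
Unset Printing Implicit Defensive.

Import Order.TTheory GRing.Theory Num.Theory.
Import numFieldNormedType.Exports.

Local Open Scope classical_set_scope.
Local Open Scope ring_scope.
Local Open Scope complex_scope.

(* The neighbourhood of 0 is punctured, so that functions with a removable
   singularity at 0, such as x / (e^x - 1), are covered. *)
Definition has_expansion0 (K : numFieldType) (f : K -> K) (a : nat -> K) : Prop :=
  \forall z \near (0 : K^o)^',
    series (fun k => a k * z ^+ k : K^o) @ \oo --> (f z : K^o).

(* Over the real and the complex numbers the coefficients are unique when they
   exist, so [get] returns the power series expansion of f about 0 whenever f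
   has one. *)
Definition expansion0 (K : numFieldType) (f : K -> K) : nat -> K :=
  get [set a : nat -> K^o | has_expansion0 f a].

Definition cexp (R : realType) (z : R[i]) : R[i] :=
  (expR (complex.Re z))%:C * (cos (complex.Im z) +i* sin (complex.Im z)).

Definition csc (R : realType) (x : R) : R := (sin x)^-1.

Definition coefA (R : realType) (nu : nat) (t : R[i]) : R[i] :=
  nu`!%:R * expansion0 (fun z : R[i] => (t * cexp z - 1)^-1) nu.

Definition bernoulli (R : realType) (k : nat) : R :=
  k`!%:R * expansion0 (fun x : R => x / (expR x - 1)) k.

(* The exponent 2j - 1 is an integer: it equals -1 when j = 0. *)
Definition coefG (R : realType) (j : nat) : R :=
  (-1) ^+ j * (2 * (2 ^ ((2 * j)%:Z - 1) - 1) * bernoulli R (2 * j))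
  / (2 * j)`!%:R.

Definition prodG (R : realType) (N : nat) (j : 'I_N -> nat) : R :=
  \prod_(r < N) coefG R (j r).

(* Main.v *)
Require Import Defs.
From HB Require Import structures.
From mathcomp Require Import all_boot all_order all_algebra.
From mathcomp Require Import all_classical all_reals all_analysis.
From mathcomp Require Import complex ring.

(** The identity is the residue theorem for
      f(w) = (e^(2imw) / (e^(2idw) - 1)) / sin^(2n) (w + a),    a = + or - pi b,
    on a period strip: since 0 < m < d, f decays at both ends of the strip, so
    the residues at the d simple poles w = pi j / d add up to minus the residue
    at the pole w = -a, where the product of the expansions of the exponential,
    of 1 / (t e^z - 1) and of 1 / sin gives the sum of products of A_nu and G_j.
    The right-hand side adds the two choices of a, which turns e^(2 pi i mj/d)
    into a cosine.

    The proof makes this algebraic, in the ring of formal power series in x over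
    the complex numbers, where a residue is a coefficient.
    - [partial_fractions_root_unity] writes z^m / (z^d - 1) as a combination of
      the 1 / (w^j z - 1), w^d = 1. It is finite Fourier inversion, and the
      bound m < d plays the role of the decay of f. It leaves one simple pole at
      a time.
    - [res_csc_pole] is the residue theorem for a single simple pole: it
      evaluates the coefficient of x^(2n-1) in
      (x / sin x)^(2n) / (xi e^(2ix) - 1). The odd part of 1 / (xi e^(2ix) - 1)
      is a multiple of sin x cos x / (sin^2 x - sin^2 alpha), and
      sin^2 x = sin^2 alpha + (sin^2 x - sin^2 alpha) lowers n by one, at the
      cost of a multiple of cos x / sin^(2n-1) x. That term is a derivative, so
      it has no residue, except for n = 1, where it yields the value
      ([res_cos_csc]).
    - [csc_gf_bernoulli] identifies the coefficients of x / sin x with the -G_j.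

    Analysis enters only to compute the expansions that define A_nu(t) and B_k.
    [has_expansion0_inv] shows that the formal inverse of a series with bounded
    coefficients converges near 0 to the inverse of its sum, by comparing the
    product of truncations with the truncated Cauchy product, and
    [has_expansion0_uniq] shows that a function has at most one expansion. Hence
    the generating functions of A_nu(t) and of B_k are the formal inverses of
    t e^z - 1 and of (e^z - 1) / z ([gfA_inv], [gfB_inv]). *)

Set Implicit Arguments.
Unset Strict Implicit.
Unset Printing Implicit Defensive.

Import Order.TTheory GRing.Theory Num.Theory.
Import numFieldNormedType.Exports.

Local Open Scope ring_scope.

(** * The ring of formal power series *)

Record fps (K : Type) := Fps { fps_coef :> nat -> K }.

HB.instance Definition _ (K : Type) := gen_eqMixin (fps K).
HB.instance Definition _ (K : Type) := gen_choiceMixin (fps K).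

Lemma fpsP (K : Type) (f g : fps K) : f =1 g -> f = g.
Proof. by case: f g => [f] [g] /= /funext ->. Qed.

Section FpsRing.
Variable K : comNzRingType.
Implicit Types f g h : fps K.

Definition fps_zero : fps K := Fps (fun=> 0).
Definition fps_opp f := Fps (fun k => - f k).
Definition fps_add f g := Fps (fun k => f k + g k).

Fact fps_addA : associative fps_add.
Proof. by move=> f g h; apply: fpsP => k; apply: addrA. Qed.
Fact fps_addC : commutative fps_add.
Proof. by move=> f g; apply: fpsP => k; apply: addrC. Qed.
Fact fps_add0 : left_id fps_zero fps_add.
Proof. by move=> f; apply: fpsP => k; apply: add0r. Qed.
Fact fps_addN : left_inverse fps_zero fps_opp fps_add.
Proof. by move=> f; apply: fpsP => k; apply: addNr. Qed.

HB.instance Definition _ :=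
  GRing.isZmodule.Build (fps K) fps_addA fps_addC fps_add0 fps_addN.

Definition fps_poly (p : {poly K}) : fps K := Fps (fun k => p`_k).

Definition fps_one : fps K := fps_poly 1.
Definition fps_mul f g := Fps (fun k => \sum_(i < k.+1) f i * g (k - i)%N).
Definition fps_trunc N f : {poly K} := \poly_(i < N) f i.

(** A coefficient of a product only involves lower coefficients, so the ring
    axioms are inherited from polynomials by truncation. *)
Lemma fps_mul_trunc N f g k : (k < N)%N ->
  fps_mul f g k = (fps_trunc N f * fps_trunc N g)`_k.
Proof.
move=> kN; rewrite coefM; apply: eq_bigr => i _; rewrite !coef_poly.
by rewrite (leq_ltn_trans (leq_subr _ _) kN) (leq_trans (ltn_ord i) kN).
Qed.

Fact fps_mulA : associative fps_mul.
Proof.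
move=> f g h; apply: fpsP => k.
pose t := fps_trunc k.+1.
transitivity ((t f * (t g * t h))`_k).
  rewrite coefM; apply: eq_bigr => i _.
  by rewrite coef_poly ltn_ord (@fps_mul_trunc k.+1) ?ltnS ?leq_subr.
rewrite mulrA coefM; apply: eq_bigr => i _.
by rewrite (@fps_mul_trunc k.+1)// coef_poly ltnS leq_subr.
Qed.

Fact fps_mulC : commutative fps_mul.
Proof.
by move=> f g; apply: fpsP => k; rewrite !(@fps_mul_trunc k.+1)// mulrC.
Qed.

Fact fps_mul1 : left_id fps_one fps_mul.
Proof.
move=> f; apply: fpsP => k /=; rewrite big_ord_recl /= coef1 mul1r subn0.
by rewrite big1 ?addr0// => i _; rewrite coef1 mul0r.
Qed.

Fact fps_mulDl : left_distributive fps_mul +%R.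
Proof.
move=> f g h; apply: fpsP => k /=; rewrite -big_split.
by apply: eq_bigr => i _; rewrite mulrDl.
Qed.

Fact fps_one_neq0 : fps_one != 0.
Proof.
apply/eqP => /(congr1 (fun f : fps K => f 0%N)) /=.
by rewrite coef1; apply/eqP; rewrite oner_eq0.
Qed.

HB.instance Definition _ := GRing.Zmodule_isComNzRing.Build (fps K)
  fps_mulA fps_mulC fps_mul1 fps_mulDl fps_one_neq0.

Lemma fpsD f g k : (f + g) k = f k + g k. Proof. by []. Qed.
Lemma fpsN f k : (- f) k = - f k. Proof. by []. Qed.
Lemma fpsB f g k : (f - g) k = f k - g k. Proof. by []. Qed.
Lemma fpsM f g k : (f * g) k = \sum_(i < k.+1) f i * g (k - i)%N.
Proof. by []. Qed.
Lemma fps1 k : (1 : fps K) k = (k == 0%N)%:R. Proof. exact: coef1. Qed.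

Lemma fpsM0 f g : (f * g) 0%N = f 0%N * g 0%N.
Proof. by rewrite fpsM big_ord_recl big_ord0 addr0. Qed.

Lemma fps_sum (I : Type) (r : seq I) (P : pred I) (F : I -> fps K) k :
  (\sum_(i <- r | P i) F i) k = \sum_(i <- r | P i) F i k.
Proof. by elim/big_ind2: _ => // _ x _ y <- <-. Qed.

Fact fps_poly_is_zmod_morphism : zmod_morphism fps_poly.
Proof. by move=> p q; apply: fpsP => k /=; rewrite coefB. Qed.
Fact fps_poly_is_monoid_morphism : monoid_morphism fps_poly.
Proof. by split=> // p q; apply: fpsP => k /=; rewrite coefM. Qed.
HB.instance Definition _ :=
  GRing.isZmodMorphism.Build _ _ fps_poly fps_poly_is_zmod_morphism.
HB.instance Definition _ :=
  GRing.isMonoidMorphism.Build _ _ fps_poly fps_poly_is_monoid_morphism.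

Definition fpsC : K -> fps K := fps_poly \o polyC.
HB.instance Definition _ := GRing.RMorphism.on fpsC.

Definition fpsX : fps K := fps_poly 'X.

Lemma coef_fpsCM c f k : (fpsC c * f) k = c * f k.
Proof.
rewrite fpsM big_ord_recl /= coefC subn0 big1 ?addr0// => i _.
by rewrite coefC mul0r.
Qed.

Lemma coef_fpsXnM n f k : (fpsX ^+ n * f) k = if (k < n)%N then 0 else f (k - n)%N.
Proof.
have hX i : (fpsX ^+ n) i = (i == n)%:R.
  by rewrite -rmorphXn /= coefXn.
rewrite fpsM; case: ltnP => kn.
  rewrite big1// => i _; rewrite hX (ltn_eqF (leq_trans (ltn_ord i) kn)).
  by rewrite mul0r.
have kn' : (n < k.+1)%N by rewrite ltnS.
rewrite (bigD1 (Ordinal kn')) //= hX eqxx mul1r big1 ?addr0// => i.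
by rewrite hX -val_eqE /= => /negbTE ->; rewrite mul0r.
Qed.

Lemma fpsX_inj f g : fpsX * f = fpsX * g -> f = g.
Proof.
move=> fg; apply: fpsP => k; move/(congr1 (fun u : fps K => u k.+1)): fg.
by rewrite -[fpsX]expr1 !coef_fpsXnM /= subn1.
Qed.

(** The Euler operator X d/dX rather than the derivative: it preserves the
    degree, so no index is shifted. *)
Definition euler f : fps K := Fps (fun k => k%:R * f k).

Lemma eulerE f k : euler f k = k%:R * f k. Proof. by []. Qed.

Fact euler_is_zmod_morphism : zmod_morphism euler.
Proof. by move=> f g; apply: fpsP => k /=; rewrite -mulrBr. Qed.
HB.instance Definition _ :=
  GRing.isZmodMorphism.Build _ _ euler euler_is_zmod_morphism.

Lemma eulerM f g : euler (f * g) = euler f * g + f * euler g.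
Proof.
apply: fpsP => k; rewrite fpsD eulerE !fpsM mulr_sumr -big_split /=.
apply: eq_bigr => i _.
have -> : k%:R = i%:R + (k - i)%:R :> K.
  by rewrite -natrD subnKC// -ltnS.
by ring.
Qed.

Lemma eulerX : euler fpsX = fpsX.
Proof.
apply: fpsP => k /=; rewrite coefX.
by case: eqVneq => [->|_]; rewrite ?mul1r ?mulr0.
Qed.

Lemma eulerC c : euler (fpsC c) = 0.
Proof.
by apply: fpsP => -[|k] /=; rewrite coefC ?mul0r ?mulr0.
Qed.

Lemma euler_exp f n : euler (f ^+ n.+1) = n.+1%:R * f ^+ n * euler f.
Proof.
elim: n => [|n IHn]; first by rewrite expr1 expr0 !mul1r.
by rewrite exprS eulerM IHn [f ^+ n.+1]exprS; ring.
Qed.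

(** The substitution of cX for X. *)
Definition fps_scale (c : K) f : fps K := Fps (fun k => c ^+ k * f k).

Lemma fps_scaleE c f k : fps_scale c f k = c ^+ k * f k. Proof. by []. Qed.

Fact fps_scale_is_zmod_morphism c : zmod_morphism (fps_scale c).
Proof. by move=> f g; apply: fpsP => k /=; rewrite -mulrBr. Qed.
Fact fps_scale_is_monoid_morphism c : monoid_morphism (fps_scale c).
Proof.
split=> [|f g]; apply: fpsP => k.
  by rewrite fps_scaleE fps1; case: k => [|k]; rewrite ?mul1r ?mulr0.
rewrite fps_scaleE !fpsM mulr_sumr; apply: eq_bigr => i _; rewrite !fps_scaleE.
by rewrite -{1}(subnKC (ltnSE (ltn_ord i))) exprD; ring.
Qed.
HB.instance Definition _ c :=
  GRing.isZmodMorphism.Build _ _ (fps_scale c) (fps_scale_is_zmod_morphism c).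
HB.instance Definition _ c :=
  GRing.isMonoidMorphism.Build _ _ (fps_scale c)
    (fps_scale_is_monoid_morphism c).

Lemma fps_scaleX c : fps_scale c fpsX = fpsC c * fpsX.
Proof.
apply: fpsP => k; rewrite coef_fpsCM /= coefX.
by case: eqVneq => [->|_]; rewrite ?expr1 ?mulr0.
Qed.

Lemma fps_scaleC c a : fps_scale c (fpsC a) = fpsC a.
Proof. by apply: fpsP => -[|k] /=; rewrite coefC ?mul1r ?mulr0. Qed.

End FpsRing.

Definition fps_map (K L : Type) (phi : K -> L) (f : fps K) : fps L :=
  Fps (fun k => phi (f k)).

Lemma fps_mapE (K L : Type) (phi : K -> L) f k : fps_map phi f k = phi (f k).
Proof. by []. Qed.

Section FpsMap.
Variables (K L : comNzRingType) (phi : {rmorphism K -> L}).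

Fact fps_map_is_zmod_morphism : zmod_morphism (fps_map phi).
Proof. by move=> f g; apply: fpsP => k /=; rewrite rmorphB. Qed.
Fact fps_map_is_monoid_morphism : monoid_morphism (fps_map phi).
Proof.
split=> [|f g]; apply: fpsP => k; rewrite fps_mapE.
  by rewrite !fps1; case: (k == _); rewrite (rmorph1,rmorph0).
by rewrite !fpsM rmorph_sum; apply: eq_bigr => i _; rewrite rmorphM.
Qed.
HB.instance Definition _ :=
  GRing.isZmodMorphism.Build _ _ (fps_map phi) fps_map_is_zmod_morphism.
HB.instance Definition _ :=
  GRing.isMonoidMorphism.Build _ _ (fps_map phi) fps_map_is_monoid_morphism.

Lemma fps_mapX : fps_map phi (fpsX K) = fpsX L.
Proof.
by apply: fpsP => k /=; rewrite !coefX; case: (k == _); rewrite (rmorph1, rmorph0).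
Qed.

End FpsMap.

Section FpsExp.
Variable K : numFieldType.
Implicit Types (a b t : K) (f g : fps K).

Definition fps_exp a : fps K := Fps (fun k => a ^+ k / k`!%:R).

Lemma fact_neq0 k : k`!%:R != 0 :> K.
Proof. by rewrite pnatr_eq0 -lt0n fact_gt0. Qed.

Lemma fps_expD a b : fps_exp (a + b) = fps_exp a * fps_exp b.
Proof.
apply: fpsP => k; rewrite fpsM /= addrC exprDn mulr_suml.
apply: eq_bigr => i _; have ik : (i <= k)%N by rewrite -ltnS.
have := bin_fact ik => /(congr1 (fun n : nat => n%:R : K)); rewrite !natrM => E.
have := fact_neq0 k; have := fact_neq0 i; have := fact_neq0 (k - i) => n1 n2 n3.
rewrite -[_ *+ _]mulr_natr.
have -> : 'C(k, i)%:R = k`!%:R / (i`!%:R * (k - i)`!%:R) :> K.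
  by rewrite -E mulfK// mulf_neq0.
by field; rewrite n1 n2 n3.
Qed.

Lemma fps_exp0 : fps_exp 0 = 1.
Proof.
by apply: fpsP => -[|k]; rewrite fps1 /= ?expr0 ?divr1// expr0n mul0r.
Qed.

Lemma fps_expXn a n : fps_exp a ^+ n = fps_exp (n%:R * a).
Proof.
elim: n => [|n IHn]; first by rewrite expr0 mul0r fps_exp0.
by rewrite exprS IHn -fps_expD; congr fps_exp; rewrite -natr1; ring.
Qed.

Lemma fps_scale_exp c a : fps_scale c (fps_exp a) = fps_exp (c * a).
Proof. by apply: fpsP => k /=; rewrite exprMn mulrA. Qed.

Lemma euler_fps_exp a : euler (fps_exp a) = fpsC a * fpsX K * fps_exp a.
Proof.
apply: fpsP => k; rewrite -mulrA coef_fpsCM -[fpsX K]expr1 coef_fpsXnM /=.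
case: k => [|k] /=; first by rewrite mul0r mulr0.
rewrite subn1 factS natrM exprS.
by field; rewrite fact_neq0 ?nat1r ?natr1 pnatr_eq0.
Qed.

End FpsExp.

Lemma fps_map_exp (K L : numFieldType) (phi : {rmorphism K -> L}) a :
  fps_map phi (fps_exp a) = fps_exp (phi a).
Proof.
by apply: fpsP => k /=; rewrite fmorph_div rmorphXn rmorph_nat.
Qed.

Section FpsInverse.
Variable K : fieldType.

Definition fps_shift (f : fps K) : fps K := Fps (fun k => f k.+1).

Lemma fps_shiftE (f : fps K) : f = fpsC (f 0%N) + fpsX K * fps_shift f.
Proof.
apply: fpsP => k; rewrite fpsD -[fpsX K]expr1 coef_fpsXnM /= coefC.
by case: k => [|k] /=; rewrite ?addr0// add0r subn1.
Qed.

(** The sum of all powers of X v; the k-th power starts in degree k, so the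
    coefficient of X^n only sees the first n + 1 of them. *)
Definition fps_geom (v : fps K) : fps K :=
  Fps (fun n => \sum_(k < n.+1) ((fpsX K * v) ^+ k) n).

Lemma fps_geomP v : fps_geom v * (1 - fpsX K * v) = 1.
Proof.
pose u := fpsX K * v; pose g n := \sum_(k < n.+1) u ^+ k.
have uN k n : (n < k)%N -> (u ^+ k) n = 0.
  by move=> nk; rewrite exprMn coef_fpsXnM nk.
have gE n m : (m <= n)%N -> fps_geom v m = g n m.
  move=> mn; rewrite /g fps_sum /= -(subnKC mn) -addSn big_split_ord /=.
  by rewrite [X in _ + X]big1 ?addr0// => i _; rewrite uN// ltnS leq_addr.
apply: fpsP => n.
transitivity ((g n * (1 - u)) n).
  rewrite !fpsM; apply: eq_bigr => i _; congr (_ * _).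
  by apply: gE; rewrite -ltnS.
have -> : g n * (1 - u) = 1 - u ^+ n.+1.
  by rewrite mulrC -[1 - u]opprB mulNr /g -subrX1 opprB.
by rewrite fpsB uN// subr0.
Qed.

Lemma fps_inv_exists (c : fps K) : c 0%N != 0 -> exists a : fps K, a * c = 1.
Proof.
move=> c0; pose i := fpsC (c 0%N)^-1.
exists (i * fps_geom (- i * fps_shift c)).
rewrite -[RHS](fps_geomP (- i * fps_shift c)).
have ic : i * fpsC (c 0%N) = 1 by rewrite -rmorphM mulVf.
set g := fps_geom _; set x := fpsX K; set s := fps_shift c.
have -> : c = fpsC (c 0%N) + x * s by exact: fps_shiftE.
have -> : i * g * (fpsC (c 0%N) + x * s) = g * (i * fpsC (c 0%N) + i * x * s).
  by ring.
by rewrite ic; ring.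
Qed.

End FpsInverse.

(** * Coefficients of products *)

Section Coefficients.
Variable K : comNzRingType.

(** The coefficient of a power of a series in X^2, as a sum over the tuples
    of exponents chosen in the N factors. *)
Lemma coef_exp_even_fps N M (h : nat -> K) (f : fps K) k : (k < M)%N ->
  (forall j, f j.*2 = h j) -> (forall j, f j.*2.+1 = 0) ->
  (f ^+ N) k = \sum_(J : {ffun 'I_N -> 'I_M} | (\sum_(r < N) 2 * J r == k)%N)
                 \prod_(r < N) h (J r).
Proof.
move=> kM f_even f_odd.
pose p : {poly K} := \sum_(j < M) (h j)%:P * 'X^(2 * j).
have fp i : (i < M)%N -> f i = p`_i.
  move=> iM; rewrite /p coef_sum.
  have [iodd|ieven] := boolP (odd i).
    rewrite -[i in LHS]odd_double_half iodd add1n f_odd big1// => j _.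
    rewrite coefCM coefXn mul2n; case: eqVneq => [ij|_]; last by rewrite mulr0.
    by move: iodd; rewrite ij odd_double.
  have ij : i = (i./2).*2 by rewrite -[LHS]odd_double_half (negbTE ieven).
  have jM : (i./2 < M)%N.
    by rewrite (leq_ltn_trans _ iM)// [leqRHS]ij -addnn leq_addl.
  rewrite ij f_even (bigD1 (Ordinal jM))//= coefCM coefXn mul2n eqxx mulr1.
  rewrite big1 ?addr0// => j; rewrite -val_eqE /= coefCM coefXn mul2n => jne.
  rewrite (inj_eq double_inj) eq_sym (negbTE jne).
  by rewrite mulr0.
have mulE n : forall i, (i < M)%N -> (f ^+ n) i = (p ^+ n)`_i.
  elim: n => [|n IHn] i iM; first by rewrite !expr0 fps1 coef1.
  rewrite !exprS fpsM coefM; apply: eq_bigr => j _; rewrite fp ?IHn//.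
    exact: leq_ltn_trans (leq_subr _ _) iM.
  exact: leq_trans (ltn_ord j) iM.
rewrite mulE//.
have -> : p ^+ N = \prod_(r < N) p by rewrite prodr_const card_ord.
rewrite /p bigA_distr_bigA coef_sum /= [RHS]big_mkcond /=.
apply: eq_bigr => J _.
rewrite big_split -rmorph_prod /= -(big_morph _ (@exprD _ 'X) (expr0 _)).
by rewrite coefCM coefXn eq_sym; case: eqP; rewrite ?mulr1 ?mulr0.
Qed.

Lemma coef_fpsM_bounded (M k : nat) (f g : fps K) : (k < M)%N ->
  (f * g) k = \sum_(r < M | (r <= k)%N) f (k - r)%N * g r.
Proof.
move=> kM; rewrite mulrC fpsM.
rewrite (big_ord_widen M (fun i => g i * f (k - i)%N)) //.
by apply: eq_bigr => i _; rewrite mulrC.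
Qed.

Lemma coef_exp_even_fps_mul2 (M N k : nat) (h : nat -> K)
    (f e g : fps K) : (k < M)%N ->
  (forall j, f j.*2 = h j) -> (forall j, f j.*2.+1 = 0) ->
  (f ^+ N * e * g) k =
  \sum_(J : {ffun 'I_N -> 'I_M}) \sum_(mu < M)
    \sum_(nu < M | ((\sum_(r < N) 2 * J r) + mu + nu == k)%N)
      (\prod_(r < N) h (J r)) * e mu * g nu.
Proof.
move=> kM f_even f_odd.
rewrite (coef_fpsM_bounded _ _ kM) [LHS]big_mkcond [RHS]exchange_big [RHS]/=.
under [RHS]eq_bigr => mu _ do
  (under eq_bigr => J _ do rewrite big_mkcond; rewrite exchange_big /=).
rewrite [RHS]exchange_big [RHS]/=.
apply: eq_bigr => nu _; case: leqP => nuk; last first.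
  rewrite big1// => mu _; rewrite big1// => J _; case: eqP => // E.
  by move: nuk; rewrite -E ltnNge leq_addl.
have kM' : (k - nu < M)%N := leq_ltn_trans (leq_subr _ _) kM.
rewrite (coef_fpsM_bounded _ _ kM') big_mkcond mulr_suml.
apply: eq_bigr => mu _; case: leqP => muk; last first.
  rewrite mul0r big1// => J _; case: eqP => // E.
  by move: muk; rewrite -E addnK ltnNge leq_addl.
rewrite (coef_exp_even_fps N (leq_ltn_trans (leq_subr mu _) kM') f_even f_odd).
rewrite !mulr_suml big_mkcond /=; apply: eq_bigr => J _.
have -> : ((\sum_(r < N) 2 * J r)%N == k - nu - mu)%N =
          ((\sum_(r < N) 2 * J r) + mu + nu == k)%N.
  set S := (\sum_(r < N) 2 * J r)%N.
  rewrite -[X in _ = (_ == X)](subnK nuk) eqn_add2r.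
  by rewrite -[X in _ = (_ == X)](subnK muk) eqn_add2r.
by [].
Qed.

End Coefficients.

(** * Residues of powers of the cosecant *)

Section CosecantResidue.
Variables (K : numFieldType) (I : K).
Hypothesis sqrI : I * I = -1.

Notation X := (fpsX K).
(* S = 2I sin x and T = 2 cos x, which keeps the formulas free of
   denominators; H below is then x / sin x. *)
Let S : fps K := fps_exp I - fps_exp (- I).
Let T : fps K := fps_exp I + fps_exp (- I).

Let I_neq0 : I != 0.
Proof. by apply: contra_eq_neq sqrI => ->; rewrite mul0r eq_sym oppr_eq0 oner_eq0. Qed.

Let expIK : fps_exp I * fps_exp (- I) = 1.
Proof. by rewrite -fps_expD subrr fps_exp0. Qed.

Lemma fpsC_inj c (f g : fps K) : c != 0 -> fpsC c * f = fpsC c * g -> f = g.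
Proof.
move=> c0 fg; apply: fpsP => k; apply: (mulfI c0).
by rewrite -!coef_fpsCM fg.
Qed.

Variable H : fps K.
Hypothesis HS : H * S = fpsC (2 * I) * X.

Lemma csc_coef0 : H 0%N = 1.
Proof.
have S0 : S 0%N = 0 by rewrite fpsB /= !expr0 subrr.
have S1 : S 1%N = 2 * I by rewrite fpsB /= !expr1 !divr1; ring.
move/(congr1 (fun u : fps K => u 1%N)): HS.
rewrite coef_fpsCM fpsM 2!big_ord_recl big_ord0 lift0 subn0 subnn S0 S1.
rewrite mulr0 !addr0 [fpsX K _]coefX mulr1.
by rewrite -[RHS]mul1r; apply: mulIf; rewrite mulf_neq0 ?pnatr_eq0.
Qed.

Lemma csc_even : fps_scale (-1) H = H.
Proof.
have SN : fps_scale (-1) S = - S.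
  by rewrite rmorphB /= !fps_scale_exp !mulN1r opprK opprB.
have /(congr1 (fps_scale (-1))) := HS.
rewrite rmorphM /= SN rmorphM /= fps_scaleC fps_scaleX rmorphN1 mulrN mulN1r mulrN => /oppr_inj E.
apply: fpsX_inj; apply: (@fpsC_inj (2 * I)); first by rewrite mulf_neq0 ?pnatr_eq0.
by rewrite !mulrA -[in LHS]HS -[in RHS]E; ring.
Qed.

Lemma csc_exp_odd n k : odd k -> (H ^+ n) k = 0.
Proof.
move=> kodd; have E : fps_scale (-1) (H ^+ n) = H ^+ n by rewrite rmorphXn /= csc_even.
have /eqP := congr1 (fun u : fps K => u k) E.
rewrite fps_scaleE -signr_odd kodd expr1 mulN1r.
by rewrite eq_sym -addr_eq0 -mulr2n mulrn_eq0 => /eqP.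
Qed.

(** The logarithmic derivative of x / sin x is 1 / x - cot x. *)
Lemma euler_csc : fpsC 2 * euler H = fpsC 2 * H - H ^+ 2 * T.
Proof.
have /(congr1 (@euler K)) := HS.
rewrite !eulerM eulerC eulerX mul0r add0r raddfB /= !euler_fps_exp.
rewrite rmorphN => E.
apply: fpsX_inj; apply: (@fpsC_inj I) => //.
have {}E : euler H * S + fpsC I * X * H * T = fpsC 2 * fpsC I * X.
  by rewrite -[fpsC 2 * fpsC I]rmorphM -E /T; ring.
have -> : fpsC I * (X * (fpsC 2 * euler H)) = H * (euler H * S).
  by rewrite [RHS]mulrCA HS rmorphM /=; ring.
rewrite (_ : euler H * S = fpsC 2 * fpsC I * X - fpsC I * X * H * T).
  by ring.
by rewrite -E addrK.
Qed.

(** The residue at 0 of 2 cos x / sin^(q+1) x, which is the derivative of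
    -2 / (q sin^q x) unless q = 0. Formally, compare the coefficients of x^q in
    the Euler derivative of (x / sin x)^q, where the two terms that do not
    involve the cosine cancel. *)
Lemma res_cos_csc q : (H ^+ q.+1 * T) q = (q == 0%N)%:R *+ 2.
Proof.
case: q => [|q].
  by rewrite expr1 fpsM0 csc_coef0 fpsD /= !expr0 !divr1 mul1r.
have := congr1 (fun u => (q.+1%:R * H ^+ q * u) q.+1) euler_csc.
have -> : q.+1%:R * H ^+ q * (fpsC 2 * euler H) = fpsC 2 * euler (H ^+ q.+1).
  by rewrite euler_exp; ring.
have -> : q.+1%:R * H ^+ q * (fpsC 2 * H - H ^+ 2 * T) =
    fpsC 2 * (fpsC q.+1%:R * H ^+ q.+1) - fpsC q.+1%:R * (H ^+ q.+2 * T).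
  by rewrite !exprS !rmorph_nat; ring.
rewrite fpsB !coef_fpsCM eulerE => /eqP.
rewrite -subr_eq0 opprB addrC subrK mulf_eq0 pnatr_eq0 /= => /eqP ->.
by rewrite mul0rn.
Qed.

Section Pole.
Variables (xi : K) (U U' : fps K).
Hypothesis xi_neq0 : xi != 0.
Hypothesis xi_neq1 : xi != 1.
Hypothesis defU : U * (fpsC xi * fps_exp (2 * I) - 1) = 1.
Hypothesis defU' : U' * (fpsC xi^-1 * fps_exp (2 * I) - 1) = 1.

(* With xi = e^(2 I alpha), s is -4 sin^2 alpha, and 2 I Q is
   cot (x + alpha) + cot (x - alpha). *)
Let Q := U + U' + 1.
Let s := xi - 2 + xi^-1.

Let s_eq : s = (xi - 1) ^+ 2 / xi.
Proof. by rewrite /s; field. Qed.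

Let s_neq0 : s != 0.
Proof. by rewrite s_eq mulf_neq0 ?invr_eq0// expf_neq0// subr_eq0. Qed.

Let exp2I : fps_exp (2 * I) = fps_exp I ^+ 2.
Proof. by rewrite fps_expXn. Qed.

Let QS : Q * (S ^+ 2 - fpsC s) = S * T.
Proof.
set e := fps_exp I; set e' := fps_exp (- I).
set x := fpsC xi; set y := fpsC xi^-1.
have xy : x * y = 1 by rewrite -rmorphM mulfV.
have -> : fpsC s = x - 2 + y by rewrite /s !(rmorphD,rmorphN,rmorph_nat).
have ee : e * e' = 1 := expIK.
pose a := x * e ^+ 2 - 1; pose b := y * e ^+ 2 - 1.
have Ua : U * a = 1 by rewrite /a -exp2I.
have Ub : U' * b = 1 by rewrite /b -exp2I.
have -> : S ^+ 2 - (x - 2 + y) = e' ^+ 2 * (a * b).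
  have -> : e' ^+ 2 * (a * b) =
      (e * e') ^+ 2 * (x * y) * e ^+ 2 - (x + y) * (e * e') ^+ 2 + e' ^+ 2.
    by rewrite /a /b; ring.
  by rewrite xy ee /S -/e -/e' sqrrB ee; ring.
have -> : Q * (e' ^+ 2 * (a * b)) =
    e' ^+ 2 * ((U * a) * b + (U' * b) * a + a * b) by rewrite /Q; ring.
rewrite Ua Ub.
have -> : e' ^+ 2 * (1 * b + 1 * a + a * b) =
    (e * e') ^+ 2 * (x * y) * e ^+ 2 - e' ^+ 2 by rewrite /a /b; ring.
by rewrite ee xy /S /T -/e -/e'; ring.
Qed.

(* Dividing Q S^2 - s Q = S T by sin^(2n) x expresses the residue of
   Q / sin^(2n) x by that of Q / sin^(2n-2) x and one covered by
   [res_cos_csc]. *)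
Let res_Q n : (H ^+ (2 * n.+1) * Q) (2 * n.+1).-1 = I * (- 4 / s) ^+ n.+1.
Proof.
have step m : s * (H ^+ (2 * m.+1) * Q) (2 * m.+1).-1 =
   - 4 * (X ^+ 2 * (H ^+ (2 * m) * Q)) (2 * m).+1
   - 2 * I * (H ^+ (2 * m).+1 * T) (2 * m)%N.
  have e2 : (2 * m.+1)%N = (2 * m).+2 by rewrite mulnS.
  rewrite e2 succnK -coef_fpsCM.
  have -> : fpsC s * (H ^+ (2 * m).+2 * Q) =
     H ^+ (2 * m) * (H * S) ^+ 2 * Q - H ^+ (2 * m).+1 * T * (H * S).
    have -> : fpsC s * (H ^+ (2 * m).+2 * Q) =
      H ^+ (2 * m).+2 * (Q * S ^+ 2 - Q * (S ^+ 2 - fpsC s)) by ring.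
    by rewrite QS !exprS; ring.
  rewrite HS fpsB; congr (_ - _).
    rewrite -coef_fpsCM; congr (fps_coef _ _).
    have -> : fpsC (- 4) = fpsC (2 * I) ^+ 2 :> fps K.
      by rewrite -rmorphXn; congr fpsC; rewrite exprMn [I ^+ 2]sqrI; ring.
    by ring.
  have -> : H ^+ (2 * m).+1 * T * (fpsC (2 * I) * X) =
     fpsC (2 * I) * (X ^+ 1 * (H ^+ (2 * m).+1 * T)) by ring.
  by rewrite coef_fpsCM coef_fpsXnM /= subn1.
elim: n => [|n IHn]; apply: (mulfI s_neq0); rewrite step res_cos_csc coef_fpsXnM.
  by rewrite muln0 /= expr1 mulr0 sub0r mulr2n; field.
have -> : ((2 * n.+1).+1 < 2)%N = false by rewrite mulnS.
rewrite muln_eq0 mul0rn mulr0 subr0 subn2 IHn.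
rewrite !exprS; field.
exact: s_neq0.
Qed.

(* Changing x into -x exchanges U and U' up to sign and an additive constant,
   so that U and U' have the same odd part. *)
Let U'_opp : fps_scale (-1) U' = - 1 - U.
Proof.
have /(congr1 (fps_scale (-1))) := defU'.
rewrite rmorphM rmorphB rmorphM /= fps_scaleC fps_scale_exp !rmorph1 => E.
set V := fps_scale (-1) U' in E *.
have ee : fps_exp (2 * I) * fps_exp (-1 * (2 * I)) = 1.
  by rewrite -fps_expD mulN1r subrr fps_exp0.
have xy : fpsC xi * fpsC xi^-1 = 1 :> fps K by rewrite -rmorphM mulfV.
set e := fps_exp (2 * I) in ee *; set e' := fps_exp (-1 * _) in E ee.
have Vx : V * (1 - fpsC xi * e) = fpsC xi * e.
  rewrite -[RHS]mulr1 -[Y in _ = _ * Y]E.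
  have -> : fpsC xi * e * (V * (fpsC xi^-1 * e' - 1)) =
    V * ((fpsC xi * fpsC xi^-1) * (e * e') - fpsC xi * e) by ring.
  by rewrite xy ee mulr1.
have -> : V = - (V * (1 - fpsC xi * e) * U).
  have -> : V * (1 - fpsC xi * e) * U = - (V * (U * (fpsC xi * e - 1))) by ring.
  by rewrite defU mulr1 opprK.
by rewrite Vx -[in RHS]defU -/e; ring.
Qed.

(** The residue at 0 of U / sin^(2n) x only sees the odd part of U, because
    1 / sin^(2n) x is even; it is therefore half of the residue of
    Q / sin^(2n) x. The right-hand side is I / 2 divided by sin^(2n) alpha, where
    xi = e^(2 I alpha). *)
Lemma res_csc_pole n : (0 < n)%N ->
  (H ^+ (2 * n) * U) (2 * n).-1 = I / 2 * (- 4 * xi / (xi - 1) ^+ 2) ^+ n.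
Proof.
case: n => // n _; set N := (2 * n.+1)%N.
have Nodd : odd N.-1 by rewrite /N mulnS /= mul2n odd_double.
have HUU' : (H ^+ N * U) N.-1 = (H ^+ N * U') N.-1.
  have E : fps_scale (-1) (H ^+ N * U') = H ^+ N * (-1 - U).
    by rewrite rmorphM rmorphXn /= U'_opp csc_even.
  have := congr1 (fun u : fps K => u N.-1) E.
  rewrite fps_scaleE -signr_odd Nodd expr1 mulN1r.
  rewrite (_ : _ * (-1 - U) = - H ^+ N - H ^+ N * U); last by ring.
  by rewrite fpsB fpsN csc_exp_odd// oppr0 sub0r => /oppr_inj ->.
have : (H ^+ N * Q) N.-1 = 2 * (H ^+ N * U) N.-1.
  rewrite (_ : H ^+ N * Q = H ^+ N * U + H ^+ N * U' + H ^+ N); last first.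
    by rewrite /Q; ring.
  by rewrite !fpsD csc_exp_odd// addr0 -HUU' mulr_natl mulr2n.
rewrite res_Q s_eq => E.
have two0 : (2 : K) != 0 by rewrite pnatr_eq0.
apply: (mulfI two0); rewrite -E invf_div mulrA.
by rewrite [RHS]mulrA [2 * (I / 2)]mulrC divfK.
Qed.

End Pole.
End CosecantResidue.

(** * Partial fractions over the roots of unity *)

Lemma sum_expr_root_unity (K : fieldType) (d : nat) (w : K) :
  w ^+ d = 1 -> w != 1 -> \sum_(j < d) w ^+ j = 0.
Proof.
move=> wd w1; have /eqP := subrX1 w d.
by rewrite wd subrr eq_sym mulf_eq0 subr_eq0 (negbTE w1) => /eqP.
Qed.

(** The partial fraction expansion of z^m / (z^d - 1). As (w^j z)^d = z^d, each
    U j is W times a geometric sum of powers of w^j z, and orthogonality of the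
    powers of w keeps only the term z^m; this is where m < d is used. *)
Lemma partial_fractions_root_unity (K : fieldType) (d m : nat) (w : K)
    (z W : fps K) (U : nat -> fps K) :
  w ^+ d = 1 -> (forall k, (0 < k < d)%N -> w ^+ k != 1) -> (m < d)%N ->
  W * (z ^+ d - 1) = 1 ->
  (forall j, (j < d)%N -> U j * (fpsC (w ^+ j) * z - 1) = 1) ->
  \sum_(j < d) fpsC (w^-1 ^+ (j * m)) * U j = fpsC d%:R * (z ^+ m * W).
Proof.
move=> wd wk md defW defU.
have w0 : w != 0.
  by apply: contra_eq_neq wd => ->; rewrite expr0n gtn_eqF ?(leq_ltn_trans _ md)// eq_sym oner_eq0.
have UE (j : 'I_d) : U j = W * \sum_(k < d) fpsC (w ^+ (j * k)) * z ^+ k.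
  have := defU j (ltn_ord j).
  set y := _ * z => E.
  have yd : y ^+ d = z ^+ d.
    by rewrite exprMn -rmorphXn -exprM mulnC exprM wd expr1n rmorph1 mul1r.
  transitivity (U j * (W * (y ^+ d - 1))).
    by rewrite yd defW mulr1.
  rewrite subrX1 [U j * _]mulrCA [U j * _]mulrA E mul1r.
  congr (W * _); apply: eq_bigr => k _.
  by rewrite exprMn -rmorphXn -exprM.
under eq_bigr => j _ do rewrite UE mulrCA mulr_sumr.
rewrite -mulr_sumr exchange_big /= (bigD1 (Ordinal md)) //= [X in _ + X]big1 ?addr0.
  rewrite (eq_bigr (fun=> z ^+ m)) => [|j _]; last first.
    by rewrite mulrA -rmorphM -exprMn mulVf// expr1n rmorph1 mul1r.
  by rewrite sumr_const card_ord rmorph_nat; ring.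
move=> k kNm.
under eq_bigr => j _ do rewrite mulrA -rmorphM.
rewrite -mulr_suml -rmorph_sum.
have wkm : w ^+ k / w ^+ m != 1.
  rewrite -[X in _ != X](divff (expf_neq0 m w0)) (inj_eq (mulIf _)) ?invr_eq0 ?expf_neq0//.
  have [km|mk] := ltnP k m.
    rewrite -(subnKC (ltnW km)) exprD -[X in X != _]mulr1 (inj_eq (mulfI (expf_neq0 _ w0))) eq_sym.
    by apply: wk; rewrite subn_gt0 km (leq_ltn_trans (leq_subr _ _) md).
  rewrite -(subnKC mk) exprD -[X in _ != X]mulr1 (inj_eq (mulfI (expf_neq0 _ w0))).
  apply: wk; rewrite (leq_ltn_trans (leq_subr _ _) (ltn_ord k)) andbT subn_gt0.
  by rewrite ltn_neqAle mk eq_sym andbT; move: kNm; rewrite -val_eqE.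
rewrite (eq_bigr (fun j : 'I_d => (w ^+ k / w ^+ m) ^+ j)).
  rewrite sum_expr_root_unity ?rmorph0 ?mul0r// exprMn exprVn -!exprM.
  by rewrite mulnC exprM wd expr1n mulnC exprM wd expr1n invr1 mulr1.
move=> j _; rewrite -[(w ^+ m)^-1]exprVn exprMn -!exprM mulrC.
by rewrite [(m * j)%N]mulnC [(k * j)%N]mulnC.
Qed.

(** * The cosecant and the Bernoulli numbers *)

(** The Bernoulli numbers give the expansion of x / sin x, because
    1 / sinh z = 2 / (e^z - 1) - 2 / (e^(2z) - 1); take z = ix. *)
Lemma csc_gf_bernoulli (K : numFieldType) (I : K) (B : fps K) :
  B * (fps_exp 1 - 1) = fpsX K ->
  (fpsC 2 * fps_scale I B - fps_scale (2 * I) B) * (fps_exp I - fps_exp (- I))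
  = fpsC (2 * I) * fpsX K.
Proof.
move=> defB.
have scB c : fps_scale c B * (fps_exp c - 1) = fpsC c * fpsX K.
  have /(congr1 (fps_scale c)) := defB.
  by rewrite rmorphM rmorphB /= fps_scale_exp fps_scaleX mulr1 rmorph1.
have B1 := scB I; have B2 := scB (2 * I).
have ee : fps_exp I * fps_exp (- I) = 1 by rewrite -fps_expD subrr fps_exp0.
have e2 : fps_exp (2 * I) = fps_exp I ^+ 2 by rewrite fps_expXn.
rewrite e2 in B2.
set b1 := fps_scale I B in B1 *; set b2 := fps_scale (2 * I) B in B2 *.
set e := fps_exp I in B1 B2 ee *; set e' := fps_exp (- I) in ee *.
transitivity ((fpsC 2 * (b1 * (e - 1)) * (e + 1) - b2 * (e ^+ 2 - 1)) * e').
  have -> : e - e' = e * (e * e') - e' by rewrite ee mulr1.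
  by ring.
rewrite B1 B2 rmorphM /=.
transitivity (fpsC 2 * fpsC I * fpsX K * (e * e')); first by ring.
by rewrite ee mulr1.
Qed.

Lemma csc_gf_bernoulli_even (K L : numFieldType) (phi : {rmorphism K -> L})
    (I : L) (B : fps K) j : I * I = -1 ->
  (fpsC 2 * fps_scale I (fps_map phi B) - fps_scale (2 * I) (fps_map phi B)) j.*2
  = phi ((-1) ^+ j * (2 - 2 ^+ (2 * j)) * B (2 * j)%N).
Proof.
move=> sqrI; rewrite fpsB coef_fpsCM !fps_scaleE fps_mapE -!mul2n exprMn.
rewrite [I ^+ _]exprM [I ^+ 2]sqrI.
rewrite rmorphM rmorphM rmorphB !rmorphXn rmorphN1 rmorph_nat /=; ring.
Qed.

Lemma fps_scale_inv_exp (K : numFieldType) (A : fps K) (t c : K) :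
  A * (fpsC t * fps_exp 1 - 1) = 1 ->
  fps_scale c A * (fpsC t * fps_exp c - 1) = 1.
Proof.
move=> /(congr1 (fps_scale c)).
by rewrite rmorphM rmorphB rmorphM /= fps_scaleC fps_scale_exp mulr1 !rmorph1.
Qed.

(** * Power series expansions of functions *)

Local Open Scope classical_set_scope.

Section Expansions.
Variable K : numFieldType.
Implicit Types (a c : fps K) (f : K -> K) (z : K).

(** The first term of the dominating geometric series accounts for at least half
    of its sum, the ratio being at most 1/2. *)
Lemma norm_sum_pow_le (M e : K) (u : nat -> K) n p :
  0 <= M -> 0 <= e <= 2^-1 -> (forall k, `|u k| <= M * e ^+ (p + k)) ->
  `|\sum_(k < n) u k| <= 2 * M * e ^+ p.
Proof.
move=> M0 /andP[e0 e2] uM.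
(* The sharper bound makes the induction on n go through. *)
apply: (@le_trans _ _ (2 * M * e ^+ p * (1 - 2^-1 ^+ n))); last first.
  have h0 : (0 : K) <= 2^-1 ^+ n by rewrite exprn_ge0// invr_ge0 ler0n.
  by rewrite ler_piMr ?mulr_ge0 ?exprn_ge0 ?ler0n// lerBlDr lerDl.
elim: n => [|n IHn]; first by rewrite big_ord0 normr0 expr0 subrr mulr0.
rewrite big_ord_recr /=; apply: (le_trans (ler_normD _ _)).
apply: (le_trans (lerD IHn (uM n))).
have : M * e ^+ (p + n) <= M * e ^+ p * 2^-1 ^+ n.
  rewrite exprD mulrA ler_wpM2l ?mulr_ge0 ?exprn_ge0//.
  by rewrite lerXn2r// nnegrE invr_ge0 ler0n.
move=> /(lerD (lexx (2 * M * e ^+ p * (1 - 2^-1 ^+ n)))) /le_trans; apply.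
rewrite [2^-1 ^+ n.+1]exprS le_eqVlt; apply/orP; left; apply/eqP.
by field.
Qed.

(** The error consists of the coefficients of degree at least n in the product
    of the truncations. That of degree k has k + 1 terms of size M^2 8^-k, hence
    size at most M^2 2^-k, since k + 1 <= 4^k. *)
Lemma cauchy_product_error (M : K) a c n :
  0 <= M -> (forall k, `|a k| <= M * 8^-1 ^+ k) ->
  (forall k, `|c k| <= M * 8^-1 ^+ k) ->
  `|(\sum_(k < n) a k) * (\sum_(k < n) c k) - \sum_(k < n) (a * c) k|
    <= 2 * M ^+ 2 * 2^-1 ^+ n.
Proof.
move=> M0 ha hc.
have e0 k : (0 : K) <= 8^-1 ^+ k by rewrite exprn_ge0// invr_ge0 ler0n.
have tr (b : fps K) k : (forall k, `|b k| <= M * 8^-1 ^+ k) ->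
    `|(fps_trunc n b)`_k| <= M * 8^-1 ^+ k.
  by move=> hb; rewrite coef_poly; case: ifP => // _; rewrite normr0 mulr_ge0.
pose p := fps_trunc n a * fps_trunc n c.
have sumE (b : fps K) : \sum_(k < n) b k = (fps_trunc n b).[1].
  rewrite (horner_coef_wide _ (size_poly _ _)).
  by apply: eq_bigr => i _; rewrite coef_poly ltn_ord expr1n mulr1.
have sp : (size p <= n + n)%N.
  apply: (leq_trans (size_polyMleq _ _)).
  by rewrite (leq_trans (leq_pred _))// leq_add// size_poly.
rewrite !sumE -hornerM (horner_coef_wide _ sp) big_split_ord /=.
rewrite -!sumE (eq_bigr (fun k : 'I_n => (a * c) k)); last first.
  by move=> i _; rewrite (@fps_mul_trunc _ n)// expr1n mulr1.
rewrite addrAC subrr add0r.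
apply: (@norm_sum_pow_le _ _ (fun k => p`_(n + k) * 1 ^+ (n + k))).
- exact: exprn_ge0.
- by rewrite invr_ge0 ler0n lexx.
move=> k; rewrite expr1n mulr1; set m := (n + k)%N.
rewrite coefM; apply: (le_trans (ler_norm_sum _ _ _)).
apply: (@le_trans _ _ (\sum_(i < m.+1) M ^+ 2 * 8^-1 ^+ m)).
  apply: ler_sum => i _; rewrite normrM.
  have -> : M ^+ 2 * 8^-1 ^+ m = M * 8^-1 ^+ i * (M * 8^-1 ^+ (m - i)).
    by rewrite -{1}(subnKC (ltnSE (ltn_ord i))) exprD; ring.
  by rewrite ler_pM// tr.
rewrite sumr_const card_ord -[_ *+ m.+1]mulr_natr -[_ * _ * _%:R]mulrA ler_wpM2l ?exprn_ge0//.
have -> : (8^-1 : K) = 2^-1 * 4^-1 by field.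
rewrite exprMn -mulrA ler_piMr ?exprn_ge0 ?invr_ge0 ?ler0n//.
rewrite exprVn mulrC ler_pdivrMr ?exprn_gt0// ?mul1r.
by rewrite -natrX ler_nat ltn_expl.
Qed.

(* An assumption, since a general numFieldType need not be archimedean; it is
   discharged for the real and for the complex numbers below. *)
Hypothesis half0 : (fun n => 2^-1 ^+ n : K^o) @ \oo --> (0 : K^o).

Lemma cvg_near_eq (u v : nat -> K) (l : K) : (\forall n \near \oo, u n = v n) ->
  (u : nat -> K^o) @ \oo --> (l : K^o) -> (v : nat -> K^o) @ \oo --> (l : K^o).
Proof.
by move=> uv; apply: cvg_trans; exact: near_eq_cvg uv.
Qed.

Lemma cvg0_half (u : nat -> K) M : (forall n, `|u n| <= M * 2^-1 ^+ n) ->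
  (u : nat -> K^o) @ \oo --> (0 : K^o).
Proof.
move=> uM.
have h : (fun n => M * 2^-1 ^+ n : K^o) @ \oo --> (0 : K^o).
  by rewrite -[X in _ --> X](mulr0 M); exact: cvgM (cvg_cst _) half0.
apply/cvgr0Pnorm_lt => e e0.
have hn := @cvgr0_norm_lt _ K^o _ _ _ _ h _ e0.
near=> n; apply: (@le_lt_trans _ _ `|M * 2^-1 ^+ n|); last by near: n; exact: hn.
by rewrite (le_trans (uM n))// real_ler_norm// ger0_real// (le_trans _ (uM n)).
Unshelve. all: by end_near. Qed.

Lemma cvg_cauchy_product (M : K) a c :
  0 <= M -> (forall k, `|a k| <= M * 8^-1 ^+ k) ->
  (forall k, `|c k| <= M * 8^-1 ^+ k) ->
  (fun n => (\sum_(k < n) a k) * (\sum_(k < n) c k) - \sum_(k < n) (a * c) k : K^o)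
    @ \oo --> (0 : K^o).
Proof.
move=> M0 ha hc; apply: (@cvg0_half _ (2 * M ^+ 2)) => n.
exact: cauchy_product_error.
Qed.

(** The product of the truncations tends to 1. The limit g is not 0, because the
    truncations of a are bounded, so the convergence of the truncations of a
    follows without any completeness of K. *)
Lemma cvg_fps_inv (M g : K) a c :
  0 <= M -> (forall k, `|a k| <= M * 8^-1 ^+ k) ->
  (forall k, `|c k| <= M * 8^-1 ^+ k) -> a * c = 1 ->
  (fun n => \sum_(k < n) c k : K^o) @ \oo --> (g : K^o) ->
  (fun n => \sum_(k < n) a k : K^o) @ \oo --> (g^-1 : K^o).
Proof.
move=> M0 ha hc ac cg.
pose A n : K^o := \sum_(k < n) a k; pose C n : K^o := \sum_(k < n) c k.
have AC1 : (fun n => A n * C n : K^o) @ \oo --> (1 : K^o).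
  have := @cvg_cauchy_product M a c M0 ha hc; rewrite ac => h.
  have h1 : (fun n => \sum_(k < n) (1 : fps K) k : K^o) @ \oo --> (1 : K^o).
    apply: (@cvg_near_eq (fun=> 1)); last exact: cvg_cst.
    near=> n.
    have n0 : (0 < n)%N by near: n; exact: nbhs_infty_gt.
    rewrite -(prednK n0) big_ord_recl fps1 big1 ?addr0// => i _.
    by rewrite fps1.
  rewrite -[X in _ --> X]add0r; apply: cvg_near_eq (cvgD h h1).
  by near=> n => /=; rewrite subrK.
have g0 : g != 0.
  apply/eqP => g0.
  have A_bound n : `|\sum_(k < n) a k| <= 2 * M.
    rewrite -[leRHS]mulr1 -[X in _ * X](expr0 (8^-1 : K)).
    apply: (@norm_sum_pow_le _ _ a) => //.
    by rewrite invr_ge0 ler0n lef_pV2 ?posrE ?ltr0n// ler_nat.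
  have : (fun n => A n * C n : K^o) @ \oo --> (0 : K^o).
    have h : (fun n => 2 * M * `|C n| : K^o) @ \oo --> (0 : K^o).
      have nC : (fun n => `|C n| : K^o) @ \oo --> (`|g| : K^o) by exact: cvg_norm.
      have -> : 0 = 2 * M * `|g| by rewrite g0 normr0 mulr0.
      exact: cvgM (cvg_cst _) nC.
    apply/cvgr0Pnorm_lt => e e0.
    have hn := @cvgr0_norm_lt _ K^o _ _ _ _ h _ e0.
    near=> n.
    apply: (@le_lt_trans _ _ `|2 * M * `|C n| |); last by near: n; exact: hn.
    rewrite normrM [leRHS]ger0_norm ?mulr_ge0// ler_wpM2r//.
    exact: A_bound.
  move=> /(@norm_cvg_unique _ K^o _ _ _ _ AC1) /eqP.
  by rewrite oner_eq0.
have CV : (fun n => (C n)^-1 : K^o) @ \oo --> (g^-1 : K^o) by exact: cvgV.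
rewrite -[X in _ --> X]mul1r; apply: cvg_near_eq (cvgM AC1 CV).
near=> n; rewrite /= mulfK//.
by near: n; exact: cvgr_neq0 cg g0.
Unshelve. all: by end_near. Qed.

(** By induction, from the recurrence
    c_0 a_(k+1) = - (c_1 a_k + ... + c_(k+1) a_0) and
    L (1 + (1+L) + ... + (1+L)^k) = (1+L)^(k+1) - 1. *)
Lemma fps_inv_bound (L : K) a c : c 0%N != 0 -> 0 <= L ->
  (forall k, `|c k.+1| <= L * `|c 0%N|) -> a * c = 1 ->
  forall k, `|a k| <= `|c 0%N|^-1 * (1 + L) ^+ k.
Proof.
move=> c0 L0 hc ac k.
have c0' : 0 < `|c 0%N| by rewrite normr_gt0.
have L1 : 0 <= 1 + L by rewrite addr_ge0.
elim/ltn_ind: k => -[_|k IH].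
  have := congr1 (fun u : fps K => u 0%N) ac; rewrite fpsM0 fps1 => E.
  have -> : a 0%N = (c 0%N)^-1 by apply: (mulIf c0); rewrite E mulVf.
  by rewrite expr0 mulr1 normfV.
have := congr1 (fun u : fps K => u k.+1) ac; rewrite mulrC fpsM fps1.
rewrite big_ord_recl subn0 => /eqP; rewrite addr_eq0 => /eqP E.
rewrite -(ler_pM2l c0') -normrM E normrN mulVKf ?lt0r_neq0//.
apply: (le_trans (ler_norm_sum _ _ _)).
apply: (@le_trans _ _ (\sum_(i < k.+1) L * (1 + L) ^+ (k - i))).
  apply: ler_sum => i _; rewrite lift0 subSS normrM.
  have := IH (k - i)%N; rewrite ltnS leq_subr => /(_ isT) h.
  apply: (le_trans (ler_pM _ _ (hc i) h)) => //.
  by rewrite mulrA mulfK ?lt0r_neq0.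
rewrite (reindex_inj rev_ord_inj) /=.
rewrite (eq_bigr (fun i : 'I_k.+1 => L * (1 + L) ^+ i)); last first.
  by move=> i _; rewrite subSS subKn// -ltnS.
rewrite -mulr_sumr.
rewrite [X in X * \sum_(_ < _) _](_ : L = (1 + L) - 1); last first.
  by rewrite addrC addKr.
by rewrite -subrX1 lerBlDr lerDl.
Qed.

Lemma has_expansion0_ord f (a : nat -> K) : has_expansion0 f a <->
  \forall z \near (0 : K^o)^',
    (fun n => \sum_(k < n) a k * z ^+ k : K^o) @ \oo --> (f z : K^o).
Proof.
rewrite /has_expansion0.
suff E z : series (fun k => a k * z ^+ k : K^o) =
    (fun n => \sum_(k < n) a k * z ^+ k : K^o).
  by split; apply: filterS => z; rewrite E.
by apply/funext => n; rewrite /series /= big_mkord.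
Qed.

(** On the disc of radius 1 / (8 (1 + L)) the terms of both series are bounded by
    those of a geometric series of ratio 1/8. *)
Lemma has_expansion0_inv (L : K) f a c : c 0%N != 0 -> 0 <= L ->
  (forall k, `|c k.+1| <= L * `|c 0%N|) -> a * c = 1 ->
  has_expansion0 f c -> has_expansion0 (fun z => (f z)^-1) a.
Proof.
move=> c0 L0 hc ac /has_expansion0_ord fc; apply/has_expansion0_ord.
have c0' : 0 < `|c 0%N| by rewrite normr_gt0.
have L1 : 0 < 1 + L by rewrite ltr_wpDr.
have r0 : 0 < (8 * (1 + L))^-1 by rewrite invr_gt0 mulr_gt0.
have := @dnbhs0_le K K^o _ r0.
move: fc; apply: filterS2 => z fz zr.
have zL : (1 + L) * `|z| <= 8^-1.
  by move: zr; rewrite invfM mulrC -ler_pdivlMl.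
have z8 : `|z| <= 8^-1.
  apply: le_trans zL; rewrite ler_peMl// lerDl//.
pose M := `|c 0%N|^-1 + (1 + L) * `|c 0%N|.
have M1 : `|c 0%N|^-1 <= M by rewrite lerDl mulr_ge0// ltW.
have M2 : (1 + L) * `|c 0%N| <= M by rewrite lerDr invr_ge0.
have M0 : 0 <= M by rewrite (le_trans _ M1)// invr_ge0.
have := @cvg_fps_inv M (f z) (fps_scale z a) (fps_scale z c) M0.
have E (b : fps K) : (fun n => \sum_(k < n) fps_scale z b k : K^o) =
    (fun n => \sum_(k < n) b k * z ^+ k : K^o).
  by apply/funext => n; apply: eq_bigr => i _; rewrite fps_scaleE mulrC.
rewrite !E; apply => //.
- move=> k; rewrite fps_scaleE normrM normrX mulrC.
  apply: (@le_trans _ _ (`|c 0%N|^-1 * ((1 + L) * `|z|) ^+ k)).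
    rewrite exprMn mulrA ler_wpM2r ?exprn_ge0//.
    exact: fps_inv_bound.
  rewrite ler_pM ?invr_ge0 ?exprn_ge0 ?mulr_ge0 ?(ltW L1)//.
  by rewrite lerXn2r// nnegrE ?mulr_ge0 ?(ltW L1)// invr_ge0.
- move=> k; rewrite fps_scaleE normrM normrX mulrC.
  apply: ler_pM => //; rewrite ?exprn_ge0//; last first.
    by rewrite lerXn2r// nnegrE invr_ge0.
  apply: le_trans M2; case: k => [|k]; first by rewrite ler_peMl// lerDl.
  by rewrite (le_trans (hc k))// ler_wpM2r// lerDr.
- by rewrite -rmorphM ac rmorph1.
Qed.

End Expansions.

(** If c_p is the first nonzero coefficient of the difference of two expansions
    of f, then near 0 the term c_p z^p dominates the sum of the later ones, so
    that the partial sums stay away from 0. *)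
Lemma has_expansion0_uniq (K : numFieldType) (f : K -> K) (a b : nat -> K) :
  has_expansion0 f a -> has_expansion0 f b -> a = b.
Proof.
move=> /has_expansion0_ord fa /has_expansion0_ord fb.
pose c k := a k - b k.
have c0 : \forall z \near (0 : K^o)^',
    (fun n => \sum_(k < n) c k * z ^+ k : K^o) @ \oo --> (0 : K^o).
  move: fa fb; apply: filterS2 => z az bz.
  rewrite -[X in _ --> X](subrr (f z)); apply: cvg_near_eq (cvgB az bz).
  by near=> n; under [RHS]eq_bigr do rewrite mulrBl; rewrite sumrB.
have [r /= r0 cr] : exists2 r : K, 0 < r & forall z, z != 0 -> `|z| < r ->
    (fun n => \sum_(k < n) c k * z ^+ k : K^o) @ \oo --> (0 : K^o).
  have /nbhs_normP[r /= r0 rP] := c0.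
  exists r => // z z0 zr; apply: rP => //=.
  by rewrite sub0r normrN.
suff cz p : c p = 0.
  by apply/funext => p; apply/eqP; rewrite -subr_eq0; apply/eqP; exact: cz.
elim/ltn_ind: p => p IH; apply/eqP/negPn/negP => cp.
pose z0 := r / 2.
have z00 : 0 < z0 by rewrite divr_gt0.
have z0r : `|z0| < r.
  by rewrite gtr0_norm// ltr_pdivrMr// ltr_pMr// ltr1n.
have [M M0 cM] : exists2 M : K, 0 < M & forall k, `|c k| * z0 ^+ k <= M.
  have h := cr z0 (lt0r_neq0 z00) z0r.
  have s0 : (fun k => c k * z0 ^+ k : K^o) @ \oo --> (0 : K^o).
    apply: cvg_series_cvg_0; apply/cvg_ex; exists (0 : K^o).
    move: h; rewrite (_ : (fun n => _) = series (fun k => c k * z0 ^+ k : K^o))//.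
    by apply/funext => n; rewrite /series /= big_mkord.
  have /cvg_seq_bounded/ex_strict_bound_gt0[M M0 hM] : cvgn (fun k => c k * z0 ^+ k : K^o).
    by apply/cvg_ex; exists (0 : K^o).
  exists M => // k; have := hM k I; rewrite /= normrM normrX [`|z0|]gtr0_norm//.
  exact: ltW.
pose A := `|c p| * z0 ^+ p.
have A0 : 0 < A by rewrite mulr_gt0 ?exprn_gt0 ?normr_gt0.
(* This e is both at most 1/2 and small enough for 2 M e < A: at the point e z0
   the later terms add up to at most 2 M e^(p+1). *)
pose e := A / (4 * M + 2 * A).
have D0 : 0 < 4 * M + 2 * A.
  apply: addr_gt0; apply: mulr_gt0 => //.
have e0 : 0 < e by rewrite divr_gt0.
have e2 : e <= 2^-1.
  rewrite ler_pdivrMr// mulrDr [X in _ + X]mulrA mulVf ?pnatr_eq0// mul1r.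
  by rewrite lerDr mulr_ge0 ?invr_ge0// mulr_ge0// ltW.
have Me : 2 * M * e < A.
  rewrite mulrA ltr_pdivrMr// mulrC ltr_pM2l// ltr_wpDr//.
    by rewrite mulr_ge0// ltW.
  by rewrite ltr_pM2r// ltr_nat.
have zr : `|e * z0| < r.
  rewrite normrM (le_lt_trans _ z0r)// ler_piMl// gtr0_norm// (le_trans e2)//.
  by rewrite invf_le1// ler1n.
have cvg := cr (e * z0) (mulf_neq0 (lt0r_neq0 e0) (lt0r_neq0 z00)) zr.
pose eta := A * e ^+ p - 2 * M * e ^+ p.+1.
have eta0 : 0 < eta by rewrite subr_gt0 exprS mulrA ltr_pM2r// exprn_gt0.
have := @cvgr0_norm_lt _ K^o _ _ _ _ cvg _ eta0.
case=> N _ /(_ (p.+1 + N)%N (leq_addl _ _)) /=; apply/negP.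
rewrite big_split_ord /= big_ord_recr /= big1 ?add0r; last first.
  by move=> i _; rewrite IH ?mul0r.
rewrite -real_leNgt ?normr_real ?gtr0_real//.
apply: le_trans (lerB_normD _ _); rewrite /eta lerB//.
  rewrite normrM normrX normrM [`|e|]gtr0_norm// [`|z0|]gtr0_norm//.
  by rewrite [(e * z0) ^+ p]exprMn [e ^+ p * _]mulrC mulrA.
apply: (@norm_sum_pow_le K M e (fun k => c (p.+1 + k)%N * (e * z0) ^+ (p.+1 + k))).
- exact: ltW.
- by rewrite (ltW e0).
- move=> k; rewrite normrM normrX normrM [`|e|]gtr0_norm// [`|z0|]gtr0_norm//.
  rewrite [(e * z0) ^+ _]exprMn mulrCA mulrC ler_wpM2r// exprn_ge0// ltW//.
Unshelve. all: by end_near. Qed.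

(** * The generating functions of A_nu(t) and of the Bernoulli numbers *)

Local Open Scope complex_scope.

Section ComplexExponential.
Variable R : realType.

Lemma half0_real : (fun n => 2^-1 ^+ n : R^o) @ \oo --> (0 : R^o).
Proof.
by apply: cvg_expr; rewrite ger0_norm ?invr_ge0// invf_lt1// ltr1n.
Qed.

Lemma normC_real (x : R) : `|x%:C| = `|x|%:C.
Proof. by rewrite normc_def /= expr0n addr0 sqrtr_sqr. Qed.

Lemma cvg_realC (u : nat -> R) (l : R) : (u : nat -> R^o) @ \oo --> (l : R^o) ->
  (fun n => (u n)%:C : R[i]^o) @ \oo --> (l%:C : R[i]^o).
Proof.
move=> ul; apply/cvgrPdist_lt => e e0.
have eR : e = (complex.Re e)%:C by rewrite RRe_real// gtr0_real.
have e0' : 0 < complex.Re e by rewrite -ltcR -eR.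
have hn := @cvgr_dist_lt _ R^o _ _ _ _ _ ul _ e0'.
near=> n.
rewrite -rmorphB normC_real eR ltcR.
by near: n; exact: hn.
Unshelve. all: by end_near. Qed.

Lemma half0_complex : (fun n => 2^-1 ^+ n : R[i]^o) @ \oo --> (0 : R[i]^o).
Proof.
have := cvg_realC half0_real; rewrite rmorph0; apply: cvg_near_eq.
by near=> n; rewrite rmorphXn fmorphV rmorph_nat.
Unshelve. all: by end_near. Qed.

Lemma cexp_coeff_im (y : R) k :
  fps_exp ('i * y%:C) k = (cos_coeff y k)%:C + 'i * (sin_coeff y k)%:C.
Proof.
have ik : 'i ^+ k = 'i ^+ odd k * (-1) ^+ k./2 :> R[i].
  by rewrite -[in LHS](odd_double_half k) exprD -mul2n exprM sqr_i.
rewrite /cos_coeff /sin_coeff /= exprMn ik.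
rewrite !rmorphM /= !fmorphV !rmorph_nat !rmorphXn !rmorphN1.
case: (boolP (odd k)) => kodd /=.
  rewrite mul0r !mul0r add0r mul1r expr1.
  have -> : (k.-1./2 = k./2)%N.
    by rewrite -[in LHS](odd_double_half k) kodd add1n /= doubleK.
  by rewrite !mulrA.
by rewrite mul0r !mul0r mulr0 addr0 expr0 !mul1r.
Qed.

(** For z = x + iy, multiply the real exponential series at x by the series of
    the cosine and the sine at y. *)
Lemma cexp_expansion : has_expansion0 (@cexp R) (fps_exp (1 : R[i])).
Proof.
apply/has_expansion0_ord.
have r0 : (0 : R[i]) < 8^-1 by rewrite invr_gt0 ltr0n.
have := @dnbhs0_le _ R[i]^o _ r0.
apply: filterS => z z8.
have zE : z = (complex.Re z)%:C + 'i * (complex.Im z)%:C := complexE z.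
set x := complex.Re z in zE *; set y := complex.Im z in zE *.
have x8 : `|x%:C| <= 8^-1.
  by rewrite normC_real (le_trans _ z8)// normc_ge_Re.
have y8 : `|'i * y%:C| <= 8^-1.
  apply: le_trans z8; rewrite normrM normC_real.
  have -> : `|'i| = 1 :> R[i] by rewrite normc_def /= expr0n expr1n add0r sqrtr1.
  by rewrite mul1r normc_def lecR -sqrtr_sqr ler_wsqrtr// lerDr sqr_ge0.
have bound (w : R[i]) k : `|w| <= 8^-1 -> `|fps_exp w k| <= 1 * 8^-1 ^+ k.
  move=> w8; rewrite mul1r /= normrM normfV normr_nat normrX.
  apply: (@le_trans _ _ (`|w| ^+ k)).
    by rewrite ler_piMr ?exprn_ge0// invf_le1 ?ltr0n ?fact_gt0// ler1n fact_gt0.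
  by rewrite lerXn2r// nnegrE ltW.
have := @cvg_cauchy_product _ half0_complex 1 (fps_exp x%:C) (fps_exp ('i * y%:C))
   ler01 (fun k => bound _ k x8) (fun k => bound _ k y8).
rewrite -fps_expD -zE => err.
have cx : (fun n => \sum_(k < n) fps_exp x%:C k : R[i]^o) @ \oo --> ((expR x)%:C : R[i]^o).
  have /cvg_realC : (series (exp_coeff x) : nat -> R^o) @ \oo --> (expR x : R^o).
    exact: is_cvg_series_exp_coeff.
  apply: cvg_near_eq; near=> n.
  rewrite /series /= big_mkord rmorph_sum; apply: eq_bigr => k _ /=.
  by rewrite rmorphM /= fmorphV rmorph_nat rmorphXn.
have cy : (fun n => \sum_(k < n) fps_exp ('i * y%:C) k : R[i]^o) @ \oo -->
    (cos y +i* sin y : R[i]^o).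
  have /cvg_realC c1 : (series (cos_coeff y) : nat -> R^o) @ \oo --> (cos y : R^o).
    by rewrite unlock; exact: is_cvg_series_cos_coeff.
  have /cvg_realC c2 : (series (sin_coeff y) : nat -> R^o) @ \oo --> (sin y : R^o).
    by rewrite unlock; exact: is_cvg_series_sin_coeff.
  have -> : cos y +i* sin y = (cos y)%:C + 'i * (sin y)%:C.
    exact: (complexE (cos y +i* sin y)).
  apply: cvg_near_eq (cvgD c1 (cvgM (cvg_cst ('i : R[i]^o)) c2)).
  near=> n; under [RHS]eq_bigr do rewrite cexp_coeff_im.
  have sE (u : nat -> R) : series u n = \sum_(k < n) u k.
    by rewrite /series /= big_mkord.
  by rewrite big_split -mulr_sumr -!rmorph_sum -!sE.
rewrite /cexp -/x -/y -[X in _ --> X]subr0.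
apply: cvg_near_eq (cvgB (cvgM cx cy) err).
near=> n.
have eE k : fps_exp 1 k * z ^+ k = fps_exp z k by rewrite /= expr1n mul1r mulrC.
under [RHS]eq_bigr do rewrite eE.
pose A := \sum_(k < n) fps_exp x%:C k.
pose B := \sum_(k < n) fps_exp ('i * y%:C) k.
transitivity (A * B - (A * B - \sum_(k < n) fps_exp z k)) => //.
by rewrite opprB addrC subrK.
Unshelve. all: by end_near. Qed.

End ComplexExponential.

Lemma expansion0_eq (K : numFieldType) (f : K -> K) (a : nat -> K) :
  has_expansion0 f a -> expansion0 f = a.
Proof.
move=> fa; apply: (has_expansion0_uniq _ fa); rewrite /expansion0.
exact: (@getPex _ [set a : nat -> K^o | has_expansion0 f a] (ex_intro _ a fa)).
Qed.

Lemma has_expansion0_affine (K : numFieldType) (t : K) f (c : fps K) :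
  has_expansion0 f c -> has_expansion0 (fun z => t * f z - 1) (fpsC t * c - 1).
Proof.
move=> /has_expansion0_ord fc; apply/has_expansion0_ord.
apply: filterS fc => z fz.
apply: cvg_near_eq (cvgB (cvgM (cvg_cst (t : K^o)) fz) (cvg_cst (1 : K^o))).
near=> n; have n0 : (0 < n)%N by near: n; exact: nbhs_infty_gt.
transitivity (t * (\sum_(k < n) c k * z ^+ k) - 1) => //.
have -> : 1 = \sum_(k < n) (1 : fps K) k * z ^+ k.
  rewrite -(prednK n0) big_ord_recl fps1 expr0 mulr1 big1 ?addr0// => i _.
  by rewrite fps1 mul0r.
rewrite mulr_sumr -sumrB; apply: eq_bigr => i _.
by rewrite fpsB coef_fpsCM mulrBl mulrA.
Unshelve. all: by end_near. Qed.

Lemma fps_exp_le1 (K : numFieldType) k : `|fps_exp (1 : K) k| <= 1.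
Proof.
by rewrite /= expr1n mul1r normfV normr_nat invf_le1 ?ltr0n ?fact_gt0// ler1n fact_gt0.
Qed.

Definition gfA (R : realType) (t : R[i]) : fps R[i] :=
  Fps (fun nu => coefA nu t / nu`!%:R).

(** The formal inverse of t e^z - 1 converges to 1 / (t e^z - 1) near 0, so by
    uniqueness its coefficients are the A_nu(t) / nu!. *)
Lemma gfA_inv (R : realType) (t : R[i]) : t != 1 ->
  gfA t * (fpsC t * fps_exp 1 - 1) = 1.
Proof.
move=> t1; set c := fpsC t * fps_exp 1 - 1.
have c0E : c 0%N = t - 1.
  by rewrite fpsB coef_fpsCM fps1 /= expr0 divr1 mulr1.
have c0 : c 0%N != 0 by rewrite c0E subr_eq0.
have [a ac] := fps_inv_exists c0.
have L0 : 0 <= `|t| / `|c 0%N| by rewrite divr_ge0.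
have hc k : `|c k.+1| <= `|t| / `|c 0%N| * `|c 0%N|.
  rewrite divfK ?normr_eq0// fpsB coef_fpsCM fps1 subr0 normrM.
  by rewrite ler_piMr// fps_exp_le1.
have := has_expansion0_inv (@half0_complex R) c0 L0 hc ac
  (has_expansion0_affine t (@cexp_expansion R)).
move=> /expansion0_eq E.
rewrite -[RHS]ac; congr (_ * _); apply: fpsP => nu.
by rewrite /gfA /= /coefA E mulrC mulKf// fact_neq0.
Qed.

Definition gfB (R : realType) : fps R := Fps (fun k => bernoulli R k / k`!%:R).

(** As for A_nu(t), with the series (e^z - 1) / z, whose constant term is not
    0. *)
Lemma gfB_inv (R : realType) : gfB R * (fps_exp 1 - 1) = fpsX R.
Proof.
pose c : fps R := Fps (fun k => (k.+1`!%:R)^-1).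
have c0E : c 0%N = 1 by rewrite /= invr1.
have c0 : c 0%N != 0 by rewrite c0E oner_eq0.
have [a ac] := fps_inv_exists c0.
have cX : fps_exp 1 - 1 = fpsX R * c.
  apply: fpsP => -[|k]; rewrite fpsB fps1 -[fpsX R]expr1 coef_fpsXnM /=.
    by rewrite expr0 divr1 subrr.
  by rewrite expr1n subr0 subn1 mul1r.
have hc k : `|c k.+1| <= 1 * `|c 0%N|.
  rewrite mul1r c0E normr1 /= normfV normr_nat invf_le1 ?ltr0n ?fact_gt0//.
  by rewrite ler1n fact_gt0.
have fc : has_expansion0 (fun x : R => (expR x - 1) / x) c.
  apply/has_expansion0_ord; near=> x.
  have x0 : x != 0 by near: x; exact: nbhs_dnbhs_neq.
  have ex : (fun n => \sum_(k < n) x ^+ k / k`!%:R : R^o) @ \oo --> (expR x : R^o).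
    have := @is_cvg_series_exp_coeff R x; apply: cvg_near_eq; near=> n.
    by rewrite /series /= big_mkord.
  have {}ex := cvg_comp _ _ (@cvg_addnr 1) ex.
  apply: cvg_near_eq
    (cvgM (cvgB ex (cvg_cst (1 : R^o))) (cvg_cst (x^-1 : R^o))).
  near=> n.
  transitivity ((\sum_(k < n + 1) x ^+ k / k`!%:R - 1) / x) => //.
  rewrite addn1 big_ord_recl expr0 divr1 addrAC subrr add0r mulr_suml.
  apply: eq_bigr => i _; rewrite lift0 exprS /=.
  by field; rewrite x0 fact_neq0.
have := has_expansion0_inv (@half0_real R) c0 ler01 hc ac fc.
move=> fa; have {fa} /expansion0_eq E : has_expansion0 (fun x : R => x / (expR x - 1)) a.
  by apply: filterS fa => x; rewrite invf_div.
rewrite cX mulrCA -[RHS]mulr1 -ac; congr (_ * (_ * _)); apply: fpsP => k.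
by rewrite /gfB /= /bernoulli E mulrC mulKf// fact_neq0.
Unshelve. all: by end_near. Qed.

(** * Trigonometry on the unit circle *)

Section Circle.
Variable R : realType.
Implicit Types x y : R.

Definition expi x : R[i] := cos x +i* sin x.

Lemma expiD x y : expi (x + y) = expi x * expi y.
Proof. by rewrite /expi cosD sinD; simpc; congr (_ +i* _); ring. Qed.

Lemma expi0 : expi 0 = 1.
Proof. by rewrite /expi cos0 sin0. Qed.

Lemma expiN_mul x : expi (- x) * expi x = 1.
Proof. by rewrite -expiD addNr expi0. Qed.

Lemma expi_neq0 x : expi x != 0.
Proof.
apply: contra_eq_neq (expiN_mul x) => ->.
by rewrite mulr0 eq_sym oner_eq0.
Qed.

Lemma expiN x : expi (- x) = (expi x)^-1.
Proof. by rewrite -[RHS]mul1r -(expiN_mul x) mulfK// expi_neq0. Qed.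

Lemma expiXn x k : expi x ^+ k = expi (k%:R * x).
Proof.
elim: k => [|k IHk]; first by rewrite expr0 mul0r expi0.
by rewrite exprS IHk -expiD; congr expi; rewrite -natr1; ring.
Qed.

Lemma expiB1 x : expi (2 * x) - 1 = 2 * 'i * (sin x)%:C * expi x.
Proof.
have -> : 2 * x = x + x by ring.
have c2 : cos x * cos x = 1 - sin x * sin x.
  by rewrite -[X in X - _](cos2Dsin2 x); ring.
rewrite /expi cosD sinD c2; simpc.
by apply/eqP; rewrite eq_complex /=; apply/andP; split; apply/eqP; ring.
Qed.

Lemma expi_sum x : expi x + expi (- x) = 2 * (cos x)%:C.
Proof.
rewrite /expi cosN sinN; simpc.
by apply/eqP; rewrite eq_complex /=; apply/andP; split; apply/eqP; ring.
Qed.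

Lemma expi_neq1 x : 0 < x < 2 * pi -> expi x != 1.
Proof.
move=> /andP[x0 x2]; have -> : x = 2 * (x / 2) by field.
rewrite -subr_eq0 expiB1 !mulf_neq0 ?pnatr_eq0 ?expi_neq0//.
  by rewrite eq_complex /= oner_eq0 andbF.
rewrite (inj_eq (@complexI R)) gt_eqF// sin_gt0_pi// divr_gt0//=.
by rewrite ltr_pdivrMr// mulrC.
Qed.

Lemma expi_int (k : int) : expi (2 * pi * k%:~R) = 1.
Proof.
have nat1 (j : nat) : expi (2 * pi * j%:R) = 1.
  rewrite mulrC -expiXn.
  have -> : expi (2 * pi) = 1.
    by rewrite mulr_natl /expi cos2pi sin2pi.
  exact: expr1n.
case: k => j; first exact: nat1.
by rewrite NegzE mulrNz mulrN expiN nat1 invr1.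
Qed.

Lemma expi_eq1 x : expi (2 * pi * x) = 1 -> exists k : int, x = k%:~R.
Proof.
move=> x1; exists (Num.floor x).
pose y := x - (Num.floor x)%:~R.
have y1 : expi (2 * pi * y) = 1.
  by rewrite /y mulrBr expiD x1 expiN expi_int invr1 mulr1.
have y0 : 0 <= y by rewrite subr_ge0 floor_le.
have yl : y < 1 by rewrite ltrBlDl -intrD1 floorD1_gt.
apply/eqP; rewrite -subr_eq0 -/y; apply: contra_eqT y1 => yn0.
apply: expi_neq1; have pi0 : 0 < 2 * pi :> R by rewrite mulr_gt0// pi_gt0.
by apply/andP; split; [rewrite mulr_gt0 // lt0r yn0 | rewrite gtr_pMr].
Qed.

Lemma cexp_imag x : cexp (2 * 'i * x%:C) = expi (2 * x).
Proof.
have -> : 2 * 'i * x%:C = 0 +i* (2 * x).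
  by apply/eqP; rewrite eq_complex /=; apply/andP; split; apply/eqP; ring.
by rewrite /cexp /= expR0 rmorph1 mul1r.
Qed.

Lemma cexp_imagN x : cexp (- (2 * 'i * x%:C)) = expi (- (2 * x)).
Proof. by rewrite -mulrN -rmorphN cexp_imag mulrN. Qed.

Lemma csc_sqr x : expi (2 * x) != 1 ->
  - 4 * expi (2 * x) / (expi (2 * x) - 1) ^+ 2 = (csc x ^+ 2)%:C.
Proof.
move=> x1; rewrite expiB1.
have s0 : (sin x)%:C != 0.
  by apply: contraNneq x1 => sx; rewrite -subr_eq0 expiB1 sx mulr0 mul0r.
have -> : expi (2 * x) = expi x ^+ 2 by rewrite expiXn.
have -> : (csc x ^+ 2)%:C = (sin x)%:C ^- 2 by rewrite /csc exprVn fmorphV rmorphXn.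
have i0 : ('i : R[i]) != 0 by rewrite eq_complex /= oner_eq0 andbF.
rewrite !exprMn sqr_i.
by field; rewrite s0 expi_neq0.
Qed.

End Circle.


(** * Assembling the sum of residues *)

Section Sums.
Variable R : realType.
Notation C := (R[i]).

Definition cscgf : fps C :=
  fpsC 2 * fps_scale 'i (fps_map (real_complex R) (gfB R))
  - fps_scale (2 * 'i) (fps_map (real_complex R) (gfB R)).

Lemma cscgf_sin : cscgf * (fps_exp 'i - fps_exp (- 'i)) = fpsC (2 * 'i) * fpsX C.
Proof.
apply: csc_gf_bernoulli.
have /(congr1 (fps_map (real_complex R))) := gfB_inv R.
by rewrite rmorphM rmorphB /= fps_map_exp fps_mapX !rmorph1.
Qed.

Lemma mulii : 'i * 'i = -1 :> C. Proof. exact: sqr_i. Qed.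

Lemma cscgf_even j : cscgf j.*2 = (- coefG R j)%:C.
Proof.
rewrite [LHS](csc_gf_bernoulli_even _ _ _ mulii).
suff -> : - coefG R j = (-1) ^+ j * (2 - 2 ^+ (2 * j)) * gfB R (2 * j).
  by [].
rewrite /coefG expfzDr ?pnatr_eq0// -exprnP exprN1 /=.
by field; rewrite fact_neq0.
Qed.

Lemma cscgf_odd j : cscgf j.*2.+1 = 0.
Proof.
by rewrite -[cscgf]expr1; apply: (csc_exp_odd mulii cscgf_sin); rewrite /= odd_double.
Qed.

Lemma scale_gfA_inv (c t : C) : t != 1 ->
  fps_scale c (gfA t) * (fpsC t * fps_exp c - 1) = 1.
Proof.
by move=> t1; apply: fps_scale_inv_exp; exact: gfA_inv.
Qed.

Lemma res_csc_gfA n x : (0 < n)%N -> expi (2 * x) != 1 ->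
  (cscgf ^+ (2 * n) * fps_scale (2 * 'i) (gfA (expi (2 * x)))) (2 * n).-1
  = 'i / 2 * (csc x ^+ (2 * n))%:C.
Proof.
move=> n0 x1.
have x1' : (expi (2 * x))^-1 != 1 by rewrite invr_eq1.
rewrite (res_csc_pole mulii cscgf_sin (expi_neq0 _) x1
          (scale_gfA_inv _ x1) (scale_gfA_inv _ x1') n0).
by rewrite csc_sqr// -rmorphXn exprM.
Qed.

(** The right-hand side is d times the residue at x = 0 of
      e^(2im(x + phi)) / ((e^(2id(x + phi)) - 1) sin^(2n) x).
    Partial fractions split off the simple poles x = - (j theta + phi), and
    [res_csc_gfA] evaluates each contribution. *)
Lemma sum_csc_residue (m n d : nat) (theta phi : R) : (0 < n)%N -> (m < d)%N ->
  expi (2 * theta) ^+ d = 1 ->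
  (forall k, (0 < k < d)%N -> expi (2 * theta) ^+ k != 1) ->
  expi (2 * (d%:R * phi)) != 1 ->
  \sum_(j < d) expi (- (2 * (j * m)%:R * theta)) * ('i / 2) *
     (csc (j%:R * theta + phi) ^+ (2 * n))%:C =
  d%:R * expi (2 * (m%:R * phi)) *
  (cscgf ^+ (2 * n) * fps_exp (m%:R * (2 * 'i)) *
     fps_scale (d%:R * (2 * 'i)) (gfA (expi (2 * (d%:R * phi))))) (2 * n).-1.
Proof.
move=> n0 md wd wk dphi.
pose w := expi (2 * theta); pose be := expi (2 * phi).
have xiE j : w ^+ j * be = expi (2 * (j%:R * theta + phi)).
  by rewrite expiXn -expiD; congr expi; ring.
have bed : be ^+ d = expi (2 * (d%:R * phi)).
  by rewrite expiXn; congr expi; ring.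
have bem : be ^+ m = expi (2 * (m%:R * phi)).
  by rewrite expiXn; congr expi; ring.
have xi1 j : expi (2 * (j%:R * theta + phi)) != 1.
  apply: contraNneq dphi; rewrite -xiE -bed => xi1.
  have <- : (w ^+ j * be) ^+ d = be ^+ d.
    by rewrite exprMn -exprM mulnC exprM wd expr1n mul1r.
  by rewrite xi1 expr1n.
pose z := fpsC be * fps_exp (2 * 'i).
pose U j := fps_scale (2 * 'i) (gfA (expi (2 * (j%:R * theta + phi)))).
pose W := fps_scale (d%:R * (2 * 'i)) (gfA (expi (2 * (d%:R * phi)))).
have defW : W * (z ^+ d - 1) = 1.
  rewrite /z exprMn -rmorphXn fps_expXn bed; exact: scale_gfA_inv.
have defU j : (j < d)%N -> U j * (fpsC (w ^+ j) * z - 1) = 1.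
  by move=> _; rewrite /z mulrA -rmorphM /= xiE; exact: scale_gfA_inv.
have pf := partial_fractions_root_unity wd wk md defW defU.
have := congr1 (fun u => (cscgf ^+ (2 * n) * u) (2 * n).-1) pf.
rewrite mulr_sumr fps_sum => E.
transitivity (\sum_(j < d) (cscgf ^+ (2 * n) *
    (fpsC (w^-1 ^+ (j * m)) * U j)) (2 * n).-1).
  apply: eq_bigr => j _; rewrite [in RHS]mulrCA coef_fpsCM res_csc_gfA// -mulrA.
  by congr (_ * _); rewrite exprVn /w expiXn -expiN; congr expi; ring.
rewrite E /z exprMn -rmorphXn fps_expXn bem -!coef_fpsCM; congr (fps_coef _ _).
by rewrite rmorphM /=; ring.
Qed.

End Sums.

Lemma sum_csc_residue_coef (R : realType) (m n d : nat) (theta phi : R) :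
  (0 < n)%N -> (m < d)%N ->
  expi (2 * theta) ^+ d = 1 ->
  (forall k, (0 < k < d)%N -> expi (2 * theta) ^+ k != 1) ->
  expi (2 * (d%:R * phi)) != 1 ->
  \sum_(j < d) expi (- (2 * (j * m)%:R * theta)) * ('i / 2) *
     (csc (j%:R * theta + phi) ^+ (2 * n))%:C =
  d%:R * expi (2 * (m%:R * phi)) *
  \sum_(J : {ffun 'I_(2 * n) -> 'I_(2 * n)}) \sum_(mu < 2 * n)
    \sum_(nu < 2 * n | ((\sum_(r < 2 * n) 2 * J r) + mu + nu == 2 * n - 1)%N)
      (\prod_(r < 2 * n) (- coefG R (J r))%:C)
      * ((m%:R * (2 * 'i)) ^+ mu / mu`!%:R)
      * ((d%:R * (2 * 'i)) ^+ nu * (coefA nu (expi (2 * (d%:R * phi))) / nu`!%:R)).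
Proof.
move=> n0 md wd wk dphi.
have kN : ((2 * n).-1 < 2 * n)%N by rewrite ltn_predL muln_gt0.
rewrite (sum_csc_residue n0 md wd wk dphi) subn1; congr (_ * _).
exact: (coef_exp_even_fps_mul2 (2 * n) (fps_exp (m%:R * (2 * 'i)))
  (fps_scale (d%:R * (2 * 'i)) (gfA _)) kN (@cscgf_even R) (@cscgf_odd R)).
Qed.

(** The contributions of phi and - phi to one summand of the final sum. *)
Lemma summand_pair_eq (K : fieldType) (I m d t t' A A' u v P : K) mu nu :
  odd (mu + nu) ->
  I * (d * t' * (P * ((m * (2 * I)) ^+ mu * u) * ((d * (2 * I)) ^+ nu * (A' * v))))
  + I * (d * t * (P * ((m * (2 * I)) ^+ mu * u) * ((d * (2 * I)) ^+ nu * (A * v))))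
  = I ^+ (mu + nu + 1) * 2 ^+ (mu + nu) * (m ^+ mu * u) * (d ^+ (nu + 1) * v)
    * (t * A - (-1) ^+ (mu + nu) * t' * A') * P.
Proof.
move=> odd_mn; rewrite -(signr_odd _ (mu + nu)) odd_mn expr1 !exprMn !exprD !expr1.
by ring.
Qed.

Unset Implicit Arguments.

Theorem theorem1p7 (R : realType) (m n d : nat) (b : R)
    (m_gt0 : (0 < m)%N) (n_gt0 : (0 < n)%N) (m_lt_d : (m < d)%N)
    (hb : ~ exists k : int, b = k%:~R / d%:R) :
  let t1 := cexp (- (2 * 'i * (pi * m%:R * b)%:C)) in
  let t2 := cexp (- (2 * 'i * (pi * d%:R * b)%:C)) in
  let t1' := cexp (2 * 'i * (pi * m%:R * b)%:C) in
  let t2' := cexp (2 * 'i * (pi * d%:R * b)%:C) in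
  (\sum_(0 <= j < d)
      cos (2 * pi * m%:R * j%:R / d%:R)
      * csc (pi * j%:R / d%:R + pi * b) ^+ (2 * n))%:C
  = - \sum_(J : {ffun 'I_(2 * n) -> 'I_(2 * n)})
      \sum_(mu < 2 * n)
      \sum_(nu < 2 * n
            | ((\sum_(r < 2 * n) 2 * J r) + mu + nu == 2 * n - 1)%N)
        'i ^+ (mu + nu + 1) * 2 ^+ (mu + nu)
        * (m%:R ^+ mu / mu`!%:R) * (d%:R ^+ (nu + 1) / nu`!%:R)
        * (t1 * coefA nu t2 - (-1) ^+ (mu + nu) * t1' * coefA nu t2')
        * (prodG R (fun r => J r : nat))%:C.
Proof.
move=> t1 t2 t1' t2'.
have d0 : (d%:R : R) != 0 by rewrite pnatr_eq0 -lt0n (leq_ltn_trans _ m_lt_d).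
have [t1E t2E t1'E t2'E] : [/\ t1 = expi (2 * (m%:R * - (pi * b))),
    t2 = expi (2 * (d%:R * - (pi * b))),
    t1' = expi (2 * (m%:R * (pi * b))) & t2' = expi (2 * (d%:R * (pi * b)))].
  by rewrite /t1 /t2 /t1' /t2' !cexp_imag !cexp_imagN; split; congr expi; ring.
have t2'1 : expi (2 * (d%:R * (pi * b))) != 1.
  apply/eqP => E; apply: hb.
  have [k kE] : exists k : int, d%:R * b = k%:~R.
    by apply: expi_eq1; rewrite -[RHS]E; congr expi; ring.
  by exists k; rewrite -kE mulrC mulKf.
have t21 : expi (2 * (d%:R * - (pi * b))) != 1.
  by rewrite !mulrN expiN invr_eq1.
have wd : expi (2 * (pi / d%:R) : R) ^+ d = 1.
  rewrite expiXn -[RHS](expi_int R 1); congr expi.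
  by rewrite mulr1; field.
have wk k : (0 < k < d)%N -> expi (2 * (pi / d%:R) : R) ^+ k != 1.
  move=> /andP[k0 kd]; rewrite expiXn; apply: expi_neq1.
  have pi2 : 0 < 2 * pi :> R by rewrite mulr_gt0// pi_gt0.
  have -> : k%:R * (2 * (pi / d%:R)) = 2 * pi * (k%:R / d%:R) :> R.
    by field.
  have dp : 0 < d%:R :> R by rewrite ltr0n (leq_ltn_trans _ kd).
  apply/andP; split; first by rewrite mulr_gt0// divr_gt0// ltr0n.
  by rewrite gtr_pMr// ltr_pdivrMr// mul1r ltr_nat.
have wdN : expi (2 * - (pi / d%:R) : R) ^+ d = 1.
  by rewrite mulrN expiN exprVn wd invr1.
have wkN k : (0 < k < d)%N -> expi (2 * - (pi / d%:R) : R) ^+ k != 1.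
  by move=> /wk; rewrite mulrN expiN exprVn invr_eq1.
(* The two signs of pi b, hence both signs of the exponent in the root of
   unity, are needed to form the cosine. *)
have Sp := sum_csc_residue_coef n_gt0 m_lt_d wd wk t2'1.
have Sm := sum_csc_residue_coef n_gt0 m_lt_d wdN wkN t21.
have cscN x : csc (- x) ^+ (2 * n) = csc x ^+ (2 * n) :> R.
  by rewrite /csc sinN invrN exprM sqrrN -exprM.
pose th : R := pi / d%:R.
transitivity (- 'i * (\sum_(j < d) expi (- (2 * (j * m)%:R * th)) * ('i / 2) *
     (csc (j%:R * th + pi * b) ^+ (2 * n))%:C +
   \sum_(j < d) expi (- (2 * (j * m)%:R * - th)) * ('i / 2) *
     (csc (j%:R * - th + - (pi * b)) ^+ (2 * n))%:C)).
  rewrite -big_split mulr_sumr rmorph_sum big_mkord /=; apply: eq_bigr => j _.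
  have -> : j%:R * - th + - (pi * b) = - (j%:R * th + pi * b) by ring.
  have -> : pi * j%:R / d%:R = j%:R * th by rewrite /th; ring.
  rewrite cscN rmorphM; set c := (_ ^+ _)%:C.
  have -> : 2 * pi * m%:R * j%:R / d%:R = 2 * (j * m)%:R * th.
    by rewrite /th natrM; ring.
  set x := 2 * (j * m)%:R * th.
  have -> : - (2 * (j * m)%:R * - th) = x by rewrite mulrN opprK.
  transitivity (- ('i * 'i) * c * ((expi x + expi (- x)) / 2)).
    rewrite mulii expi_sum opprK mul1r [2 * _]mulrC mulfK ?pnatr_eq0//.
    exact: mulrC.
  by ring.
rewrite /th Sp Sm t1E t2E t1'E t2'E mulNr mulrDr !mulr_sumr -big_split.
congr (- _); apply: eq_bigr => J _.
rewrite !mulr_sumr -big_split; apply: eq_bigr => mu _.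
rewrite !mulr_sumr -big_split; apply: eq_bigr => nu /eqP E.
have odd_mn : odd (mu + nu).
  have := congr1 odd E; rewrite -addnA oddD oddB ?muln_gt0// oddM.
  rewrite (_ : odd (\sum_(r < 2 * n) 2 * J r)%N = false) //.
  by rewrite -big_distrr oddM.
have -> : (prodG R (fun r => J r : nat))%:C
    = \prod_(r < 2 * n) (- coefG R (J r))%:C.
  rewrite /prodG -rmorph_prod; congr (real_complex _).
  by rewrite prodrN card_ord exprM sqrrN !expr1n mul1r.
exact: summand_pair_eq.
Qed.
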